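(* Let $E\subset L^2_\mu(\mathbb{R}_B)$ be a closed subspace of $L^2_\mu(\mathbb{R}_B)$. Then the following are equivalent: (1) $M_{\iota(e_\lambda)}E=E$ for all $\lambda\in\mathbb{R}$. (2) There exists a measurable set $\sigma\subset\mathbb{R}_B$, unique up to a set of $\mu$-measure $0$, such that $$E=M_{\mathbf{1}_\sigma}L^2_\mu(\mathbb{R}_B)=\{f\in L^2_\mu(\mathbb{R}_B): f=0\ \mu\text{-a.e. on }\mathbb{R}_B\setminus\sigma\}.$$
   Context: $\mathbb{R}_B$ denotes the Bohr compactification of $\mathbb{R}$: the compact abelian group of all (not necessarily continuous) characters $\xi:\mathbb{R}\to\mathbb{T}=\{z\in\mathbb{C}:|z|=1\}$, i.e. the dual group of $\mathbb{R}$ with the discrete topology (here the dual group $\mathbb{R}^*$ is identified with $\mathbb{R}$ through the characters $x\mapsto e^{i\theta x}$, $\theta\in\mathbb{R}$). $\mu$ is the normalised Haar measure on $\mathbb{R}_B$, with $\mu(\mathbb{R}_B)=1$. $L^2_\mu(\mathbb{R}_B)$ is the complex Hilbert space of (classes modulo $\mu$-a.e. equality of) square-integrable functions $f:\mathbb{R}_B\to\mathbb{C}$ with inner product $\langle f,g\rangle=\int_{\mathbb{R}_B}f\,\overline{g}\,d\mu$, and $L^\infty_\mu(\mathbb{R}_B)$ is the space of $\mu$-essentially bounded measurable functions. For $\lambda\in\mathbb{R}$, $e_\lambda$ is the function $x\mapsto e^{i\lambda x}$ on $\mathbb{R}$. The Besicovitch space $AP^2$ is the completion of the linear span $\mathcal{T}$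 of $\{e_\lambda:\lambda\in\mathbb{R}\}$ with respect to the inner product $\langle p,q\rangle=\lim_{R\to\infty}\frac{1}{2R}\int_{-R}^{R}p(x)\overline{q(x)}\,dx$. $\iota:AP^2\to L^2_\mu(\mathbb{R}_B)$ is the canonical Hilbert space isomorphism identifying the two spaces; it is determined by $\iota(e_\lambda)(\xi)=\xi(\lambda)$ for $\xi\in\mathbb{R}_B$, $\lambda\in\mathbb{R}$, so each $\iota(e_\lambda)$ is a continuous function on $\mathbb{R}_B$ of modulus $1$. For $h\in L^\infty_\mu(\mathbb{R}_B)$, $M_h:L^2_\mu(\mathbb{R}_B)\to L^2_\mu(\mathbb{R}_B)$ is the multiplication operator $\varphi\mapsto h\varphi$. For a measurable set $\sigma\subset\mathbb{R}_B$, $\mathbf{1}_\sigma$ is its characteristic function. *)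

(* Defs.v *)
From HB Require Import structures.
From mathcomp Require Import all_boot all_order all_algebra.
From mathcomp Require Import generic_quotient.
From mathcomp Require Import all_classical all_reals all_analysis.
From mathcomp Require Import measurable_realfun complex ring lra.

Set Implicit Arguments.
Unset Strict Implicit.
Unset Printing Implicit Defensive.
Import Order.TTheory GRing.Theory Num.Def Num.Theory.
Import numFieldNormedType.Exports.
Local Open Scope classical_set_scope.
Local Open Scope ring_scope.
Local Open Scope complex_scope.

(* Real-valued real part, imaginary part and modulus; those of ssrnum take
   values in R[i]. *)
Notation reC := complex.Re.
Notation imC := complex.Im.
Notation modC := ComplexField.Normc.normc.

Section complex_functions.
Context d (T : measurableType d) (R : realType).
Variable mu : {measure set T -> \bar R}.
Implicit Types f g h : T -> R[i].

Definition cmeasurable_fun f :=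
  measurable_fun [set: T] (fun x => reC (f x)) /\
  measurable_fun [set: T] (fun x => imC (f x)).

Definition cintegrable f :=
  mu.-integrable [set: T] (fun x => (reC (f x))%:E) /\
  mu.-integrable [set: T] (fun x => (imC (f x))%:E).

Definition cintegral f : R[i] :=
  (\int[mu]_x reC (f x)) +i* (\int[mu]_x imC (f x)).

Lemma reCD (z w : R[i]) : reC (z + w) = reC z + reC w.
Proof. by case: z w => [a b] [c e]. Qed.
Lemma imCD (z w : R[i]) : imC (z + w) = imC z + imC w.
Proof. by case: z w => [a b] [c e]. Qed.
Lemma reCM (z w : R[i]) : reC (z * w) = reC z * reC w - imC z * imC w.
Proof. by case: z w => [a b] [c e]. Qed.
Lemma imCM (z w : R[i]) : imC (z * w) = reC z * imC w + imC z * reC w.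
Proof. by case: z w => [a b] [c e]. Qed.
Lemma reCJ (z : R[i]) : reC (z^*)%R = reC z.
Proof. by case: z. Qed.
Lemma imCJ (z : R[i]) : imC (z^*)%R = - imC z.
Proof. by case: z. Qed.
Lemma modC2 (z : R[i]) : modC z ^+ 2 = reC z ^+ 2 + imC z ^+ 2.
Proof. by case: z => a b /=; rewrite sqr_sqrtr// addr_ge0// sqr_ge0. Qed.
Lemma modC_ge0 (z : R[i]) : 0 <= modC z.
Proof. by case: z => a b /=; rewrite sqrtr_ge0. Qed.

Lemma cmeasurable_funD f g : cmeasurable_fun f -> cmeasurable_fun g ->
  cmeasurable_fun (f \+ g).
Proof.
move=> [fr fi] [gr gi]; split.
  rewrite (_ : (fun _ => _) = (fun x => reC (f x)) \+ (fun x => reC (g x))).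
    exact: measurable_funD.
  by apply/funext => x; rewrite /= reCD.
rewrite (_ : (fun _ => _) = (fun x => imC (f x)) \+ (fun x => imC (g x))).
  exact: measurable_funD.
by apply/funext => x; rewrite /= imCD.
Qed.

Lemma cmeasurable_funM f g : cmeasurable_fun f -> cmeasurable_fun g ->
  cmeasurable_fun (fun x => f x * g x).
Proof.
move=> [fr fi] [gr gi]; split.
  rewrite (_ : (fun _ => _) = ((fun x => reC (f x)) \* (fun x => reC (g x)))
     \- ((fun x => imC (f x)) \* (fun x => imC (g x)))).
    by apply: measurable_funB; exact: measurable_funM.
  by apply/funext => x; rewrite /= reCM.
rewrite (_ : (fun _ => _) = ((fun x => reC (f x)) \* (fun x => imC (g x)))
     \+ ((fun x => imC (f x)) \* (fun x => reC (g x)))).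
  by apply: measurable_funD; exact: measurable_funM.
by apply/funext => x; rewrite /= imCM.
Qed.

Lemma cmeasurable_funJ f : cmeasurable_fun f ->
  cmeasurable_fun (fun x => (f x)^*%R).
Proof.
move=> [fr fi]; split; first by under eq_fun do rewrite reCJ.
under eq_fun do rewrite imCJ.
exact: measurable_funN.
Qed.

Lemma cmeasurable_cst (z : R[i]) : cmeasurable_fun (fun _ => z).
Proof. by split; exact: measurable_cst. Qed.

Lemma measurable_modC2 f : cmeasurable_fun f ->
  measurable_fun [set: T] (fun x => (modC (f x) ^+ 2)%:E).
Proof.
move=> [fr fi]; apply/measurable_EFinP; under eq_fun do rewrite modC2.
by apply: measurable_funD; apply: measurable_funX.
Qed.

Lemma cintegralD f g : cintegrable f -> cintegrable g ->
  cintegral (f \+ g) = cintegral f + cintegral g.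
Proof.
move=> [fr fi] [gr gi]; rewrite /cintegral.
under eq_Rintegral do rewrite reCD.
under [X in _ +i* X]eq_Rintegral do rewrite imCD.
by rewrite RintegralD//= RintegralD.
Qed.

Lemma cintegralZ (z : R[i]) f : cintegrable f ->
  cintegral (fun x => z * f x) = z * cintegral f.
Proof.
move=> [fr fi]; rewrite /cintegral.
have iZ (a : R) (h : T -> R) : mu.-integrable [set: T] (fun x => (h x)%:E) ->
    mu.-integrable [set: T] (fun x => (a * h x)%:E).
  by move=> ih; under eq_fun do rewrite EFinM; exact: integrableZl.
under eq_Rintegral do rewrite reCM.
under [X in _ +i* X]eq_Rintegral do rewrite imCM.
rewrite RintegralB ?RintegralD ?RintegralZl//; try exact: iZ.
by case: z.
Qed.

Lemma cintegralJ f : cintegrable f ->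
  cintegral (fun x => (f x)^*%R) = ((cintegral f)^*)%R.
Proof.
move=> [fr fi]; rewrite /cintegral.
under eq_Rintegral do rewrite reCJ.
under [X in _ +i* X]eq_Rintegral do rewrite imCJ -mulN1r.
by rewrite RintegralZl// mulN1r.
Qed.

Lemma eq_cintegral f g : cmeasurable_fun f -> cmeasurable_fun g ->
  f = g %[ae mu] -> cintegral f = cintegral g.
Proof.
move=> [fr fi] [gr gi] fg; rewrite /cintegral /Rintegral.
congr (fine _ +i* fine _); apply: ae_eq_integral => //;
  by [exact/measurable_EFinP|apply: filterS fg => x /= /[apply] ->].
Qed.

Definition L2fun : {pred T -> R[i]} :=
  [pred f | `[< cmeasurable_fun f /\
                (\int[mu]_x ((modC (f x)) ^+ 2)%:E < +oo)%E >]].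

Lemma L2funP f : reflect (cmeasurable_fun f /\
  (\int[mu]_x ((modC (f x)) ^+ 2)%:E < +oo)%E) (f \in L2fun).
Proof. exact: asboolP. Qed.

Lemma L2fun_integrable f : f \in L2fun ->
  mu.-integrable [set: T] (fun x => (modC (f x) ^+ 2)%:E).
Proof.
move=> /L2funP[mf fi]; apply/integrableP; split; first exact: measurable_modC2.
by under eq_integral do rewrite gee0_abs ?lee_fin ?sqr_ge0//.
Qed.

Lemma norm_dot2_le (p q r s : R) :
  `|p * r + q * s| <= p ^+ 2 + q ^+ 2 + (r ^+ 2 + s ^+ 2).
Proof.
have := sqr_ge0 (p + r); have := sqr_ge0 (p - r).
have := sqr_ge0 (q + s); have := sqr_ge0 (q - s).
have := sqr_ge0 p; have := sqr_ge0 q; have := sqr_ge0 r; have := sqr_ge0 s.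
by rewrite ler_norml !expr2 => *; apply/andP; split; nra.
Qed.

Lemma L2funM_integrable f g : f \in L2fun -> g \in L2fun ->
  cintegrable (fun x => f x * (g x)^*%R).
Proof.
move=> fL gL.
have /L2funP[mf _] := fL; have /L2funP[mg _] := gL.
have [mr mi] := cmeasurable_funM mf (cmeasurable_funJ mg).
have iS : mu.-integrable [set: T]
    (fun x => (modC (f x) ^+ 2)%:E + (modC (g x) ^+ 2)%:E)%E.
  by apply: integrableD => //; exact: L2fun_integrable.
split; apply: le_integrable iS => //; try exact/measurable_EFinP.
  move=> x _ /=; rewrite lee_fin [leRHS]ger0_norm ?addr_ge0 ?sqr_ge0//.
  by rewrite reCM reCJ imCJ !modC2 mulrN opprK; exact: norm_dot2_le.
move=> x _ /=; rewrite lee_fin [leRHS]ger0_norm ?addr_ge0 ?sqr_ge0//.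
rewrite imCM reCJ imCJ !modC2.
have := norm_dot2_le (reC (f x)) (imC (f x)) (- imC (g x)) (reC (g x)).
by rewrite sqrrN [in X in _ <= _ + X -> _]addrC.
Qed.

Lemma L2fun_submod_closed : submod_closed L2fun.
Proof.
split.
  apply/L2funP; split; first exact: cmeasurable_cst.
  by under eq_integral do rewrite /= expr0n/= addr0 sqrtr0 expr0n/=;
     rewrite integral0 ltry.
move=> a f g fL gL.
have /L2funP[mf _] := fL; have /L2funP[mg _] := gL.
have mh : cmeasurable_fun (a *: f + g).
  by apply: cmeasurable_funD => //; apply: cmeasurable_funM => //;
    exact: cmeasurable_cst.
apply/L2funP; split => //.
have iS : mu.-integrable [set: T] (fun x =>
    (2 * modC a ^+ 2)%:E * (modC (f x) ^+ 2)%:E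
    + 2%:E * (modC (g x) ^+ 2)%:E)%E.
  by apply: integrableD => //; apply: integrableZl => //; exact: L2fun_integrable.
have /integrableP[_] : mu.-integrable [set: T]
    (fun x => (modC ((a *: f + g) x) ^+ 2)%:E).
  apply: le_integrable iS => //; first exact: measurable_modC2.
  move=> x _ /=; rewrite lee_fin !ger0_norm ?sqr_ge0//.
    rewrite -[(a *: f + g) x]/(a * f x + g x).
    rewrite !modC2 reCD imCD reCM imCM.
    move: (reC a) (imC a) (reC (f x)) (imC (f x)) (reC (g x)) (imC (g x)).
    move=> p q r s t u.
    have := sqr_ge0 (p * r - q * s - t); have := sqr_ge0 (p * s + q * r - u).
    nra.
  by apply: addr_ge0; rewrite !mulr_ge0 ?modC_ge0.
by under eq_integral do rewrite gee0_abs ?lee_fin ?sqr_ge0//.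
Qed.

HB.instance Definition _ := GRing.isSubmodClosed.Build _ _ L2fun
  L2fun_submod_closed.

Record L2fun_type := L2Fun { L2fun_val :> T -> R[i]; _ : L2fun_val \in L2fun }.

HB.instance Definition _ := [isSub for L2fun_val].
HB.instance Definition _ := [Choice of L2fun_type by <:].
HB.instance Definition _ := [SubChoice_isSubLmodule of L2fun_type by <:].

End complex_functions.

Section dot_norm.
Variables (C : numClosedFieldType) (U : lmodType C) (form : {dot U for conjC}).
Local Notation "''[' u , v ]" := (form u%R v%R) : ring_scope.
Local Notation "''[' u ]" := '[u, u]%R : ring_scope.

(* The library proves the Cauchy-Schwarz and triangle inequalities only for
   finite-dimensional spaces. *)
Lemma dot_CauchySchwarz (u v : U) : `|'[u, v]| <= sqrtC '[u] * sqrtC '[v].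
Proof.
rewrite -(sqrCK (normr_ge0 _)) -sqrtCM ?nnegrE// ler_sqrtC ?nnegrE ?mulr_ge0//.
have [->|v0] := eqVneq v 0; first by rewrite !linear0r normr0 expr0n.
have [a [w [-> ow]]] : exists a w, u = w + a *: v /\ '[w, v] = 0.
  exists ('[u, v] / '[v]), (u - ('[u, v] / '[v]) *: v); rewrite subrK; split=> //.
  rewrite linearBl/= linearZl_LR divfK; first exact: subrr.
  by rewrite dnorm_eq0.
rewrite linearDl/= ow add0r linearZl_LR/= normrM (ger0_norm (dnorm_ge0 _ _)).
rewrite exprMn hnormDd/=; last by rewrite linearZr_LR/= ow mulr0.
by rewrite dnormZ mulrDl expr2 mulrA lerDr mulr_ge0.
Qed.

Lemma dot_triangle (u v : U) : sqrtC '[u + v] <= sqrtC '[u] + sqrtC '[v].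
Proof.
rewrite -ler_sqr ?nnegrE ?addr_ge0 ?sqrtC_ge0// sqrrD !sqrtCK addrAC dnormD.
rewrite lerD2l -mulr_natr -[_ + _](divfK (negbT (pnatr_eq0 C 2))) -/('Re _).
rewrite ler_pM2r ?ltr0n// (le_trans _ (dot_CauchySchwarz u v))//.
by have [] := leif_Re_Creal '[u, v]; rewrite ReE.
Qed.

End dot_norm.

Section L2.
Context d (T : measurableType d) (R : realType).
Variable mu : {measure set T -> \bar R}.
Local Notation F := (L2fun_type mu).

Definition L2_equiv (f g : F) := `[< (f : T -> R[i]) = g %[ae mu] >].

Let L2_equiv_refl : reflexive L2_equiv.
Proof. by move=> f; apply/asboolP; exact: nearW. Qed.

Let L2_equiv_sym : symmetric L2_equiv.
Proof.
by move=> f g; apply/idP/idP => /asboolP fg; apply/asboolP;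
  apply: filterS fg => x /= /[apply].
Qed.

Let L2_equiv_trans : transitive L2_equiv.
Proof.
move=> g f h /asboolP fg /asboolP gh; apply/asboolP.
by apply: filterS2 fg gh => x /= fg gh Tx; rewrite fg ?gh.
Qed.

Canonical L2_equiv_canonical :=
  EquivRel L2_equiv L2_equiv_refl L2_equiv_sym L2_equiv_trans.

Local Open Scope quotient_scope.

Definition L2 : Type := {eq_quot L2_equiv}.
HB.instance Definition _ := Choice.on L2.
HB.instance Definition _ := EqQuotient.on L2.

Definition L2_class (f : F) : L2 := \pi_L2 f.
Definition L2_fun (u : L2) : T -> R[i] := repr u.

Lemma L2_classP (f g : F) :
  L2_class f = L2_class g <-> (f : T -> R[i]) = g %[ae mu].
Proof.
split; first by move=> /eqquotP /asboolP.
by move=> fg; apply/eqquotP/asboolP.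
Qed.

Lemma L2_funK (u : L2) : L2_class (repr u) = u.
Proof. exact: reprK. Qed.

Lemma L2_fun_class (f : F) : L2_fun (L2_class f) = f %[ae mu].
Proof. by apply/L2_classP; rewrite L2_funK. Qed.

Let add (u v : L2) := L2_class (repr u + repr v).
Let opp (u : L2) := L2_class (- repr u).
Let scale (a : R[i]) (u : L2) := L2_class (a *: repr u).

Let addE f g : add (L2_class f) (L2_class g) = L2_class (f + g).
Proof.
apply/L2_classP; apply: filterS2 (L2_fun_class f) (L2_fun_class g).
by move=> x fE gE _; have := (fE I, gE I) => -[+ +]; rewrite /L2_fun => {}fE {}gE;
  rewrite -[LHS]/(repr (L2_class f) x + repr (L2_class g) x) fE gE.
Qed.

Let oppE f : opp (L2_class f) = L2_class (- f).
Proof.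
apply/L2_classP; apply: filterS (L2_fun_class f) => x fE _.
by rewrite -[LHS]/(- L2_fun (L2_class f) x) fE.
Qed.

Let scaleE a f : scale a (L2_class f) = L2_class (a *: f).
Proof.
apply/L2_classP; apply: filterS (L2_fun_class f) => x fE _.
by rewrite -[LHS]/(a * L2_fun (L2_class f) x) fE.
Qed.

Let addA : associative add.
Proof.
by move=> u v w; rewrite -[u]L2_funK -[v]L2_funK -[w]L2_funK !addE addrA.
Qed.

Let addC : commutative add.
Proof. by move=> u v; rewrite /add addrC. Qed.

Let add0 : left_id (L2_class 0) add.
Proof. by move=> u; rewrite -[u]L2_funK addE add0r. Qed.

Let addN : left_inverse (L2_class 0) opp add.
Proof. by move=> u; rewrite -[u]L2_funK oppE addE addNr. Qed.

HB.instance Definition _ := GRing.isZmodule.Build L2 addA addC add0 addN.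

Let scaleA a b u : scale a (scale b u) = scale (a * b) u.
Proof. by rewrite -[u]L2_funK !scaleE scalerA. Qed.

Let scale1 : left_id 1 scale.
Proof. by move=> u; rewrite -[u]L2_funK scaleE scale1r. Qed.

Let scaleDr : right_distributive scale +%R.
Proof.
move=> a u v; rewrite -[u]L2_funK -[v]L2_funK.
by rewrite -[LHS]/(scale a (add _ _)) -[RHS]/(add _ _) addE !scaleE addE scalerDr.
Qed.

Let scaleDl u : {morph scale^~ u : a b / a + b}.
Proof.
move=> a b /=; rewrite -[u]L2_funK.
by rewrite -[RHS]/(add _ _) !scaleE addE scalerDl.
Qed.

HB.instance Definition _ :=
  GRing.Zmodule_isLmodule.Build R[i] L2 scaleA scale1 scaleDr scaleDl.

Lemma L2_classD f g : L2_class (f + g) = L2_class f + L2_class g.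
Proof. by rewrite -addE. Qed.

Lemma L2_classZ a f : L2_class (a *: f) = a *: L2_class f.
Proof. by rewrite -scaleE. Qed.

Lemma L2_funD (u v : L2) : L2_fun (u + v) = L2_fun u \+ L2_fun v %[ae mu].
Proof. exact: L2_fun_class. Qed.

Lemma L2_funZ a (u : L2) :
  L2_fun (a *: u) = (fun x => a * L2_fun u x) %[ae mu].
Proof. exact: L2_fun_class. Qed.

Lemma L2_fun0 : L2_fun 0 = cst 0 %[ae mu].
Proof. exact: L2_fun_class. Qed.

Lemma L2_fun_inj (u v : L2) : L2_fun u = L2_fun v %[ae mu] -> u = v.
Proof. by move=> uv; rewrite -[u]L2_funK -[v]L2_funK; exact/L2_classP. Qed.

Lemma L2_fun_L2fun (u : L2) : L2_fun u \in L2fun mu.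
Proof. exact: valP. Qed.

Lemma cmeasurable_L2_fun (u : L2) : cmeasurable_fun (L2_fun u).
Proof. by have /L2funP[] := L2_fun_L2fun u. Qed.

Definition L2dot (u v : L2) : R[i] :=
  cintegral mu (fun x => L2_fun u x * (L2_fun v x)^*%R).

Let cmL2dot (u v : L2) :
  cmeasurable_fun (fun x => L2_fun u x * (L2_fun v x)^*%R).
Proof.
by apply: cmeasurable_funM; [|apply: cmeasurable_funJ];
  exact: cmeasurable_L2_fun.
Qed.

Let L2dot_linearl (v : L2) : linear_for *%R (L2dot^~ v).
Proof.
move=> a u w; rewrite /L2dot.
have iu := L2funM_integrable (L2_fun_L2fun u) (L2_fun_L2fun v).
have iw := L2funM_integrable (L2_fun_L2fun w) (L2_fun_L2fun v).
have iau : cintegrable mu (fun x => a * (L2_fun u x * (L2_fun v x)^*%R)).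
  have := L2funM_integrable (rpredZ a (L2_fun_L2fun u)) (L2_fun_L2fun v).
  congr (cintegrable mu); apply/funext => x.
  by rewrite mulrA.
rewrite -cintegralZ// -cintegralD//; apply: eq_cintegral => //.
  apply: cmeasurable_funD => //; apply: cmeasurable_funM => //.
apply: filterS2 (L2_funD (a *: u) w) (L2_funZ a u) => x /= hD hZ _.
by rewrite hD// hZ// mulrDl mulrA.
Qed.

Let L2dot_conj (u v : L2) : L2dot u v = (-1) ^+ false * (L2dot v u)^*%R.
Proof.
rewrite expr0 mul1r /L2dot -cintegralJ; last first.
  by apply: L2funM_integrable; exact: L2_fun_L2fun.
congr (cintegral mu); apply/funext => x.
by rewrite rmorphM/= conjCK mulrC.
Qed.

Let L2dot_linearr (u : L2) : linear_for (conjC \; *%R) (L2dot u).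
Proof.
move=> a v w; rewrite L2dot_conj (L2dot_linearl u a v w) expr0 mul1r.
rewrite rmorphD rmorphM/=.
by rewrite (L2dot_conj u v) (L2dot_conj u w) expr0 !mul1r.
Qed.

HB.instance Definition _ := bilinear_isBilinear.Build R[i] L2 L2 R[i]
  ( *%R ) (conjC \; *%R) L2dot (L2dot_linearl, L2dot_linearr).
HB.instance Definition _ :=
  isHermitianSesquilinear.Build R[i] L2 false conjC L2dot L2dot_conj.

Lemma L2dotE (u : L2) :
  L2dot u u = (fine (\int[mu]_x (modC (L2_fun u x) ^+ 2)%:E))%:C.
Proof.
rewrite /L2dot /cintegral; congr (_ +i* _).
  by congr fine; apply: eq_integral => x _;
    rewrite modC2 reCM reCJ imCJ mulrN opprK !expr2.
rewrite /Rintegral (eq_integral (cst 0%E)) ?integral0// => x _ /=.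
by rewrite imCM reCJ imCJ mulrN mulrC addNr.
Qed.

Let L2dot_def (u : L2) : u != 0 -> 0 < L2dot u u.
Proof.
move=> u0; rewrite L2dotE ltcR lt_def.
rewrite fine_ge0 ?integral_ge0 ?andbT//; last by move=> x _; rewrite lee_fin sqr_ge0.
apply: contra u0 => /eqP h; apply/eqP/L2_fun_inj.
have /L2funP[mu_ uoo] := L2_fun_L2fun u.
have /ae_eq_integral_abs : measurable_fun setT (fun x => (modC (L2_fun u x) ^+ 2)%:E).
  exact: measurable_modC2.
move=> /(_ mu measurableT) [+ _].
have -> : (\int[mu]_x `|(modC (L2_fun u x) ^+ 2)%:E| = 0)%E.
  under eq_integral do rewrite gee0_abs ?lee_fin ?sqr_ge0//.
  rewrite -[LHS]fineK ?h// ge0_fin_numE//.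
  by apply: integral_ge0 => x _; rewrite lee_fin sqr_ge0.
move=> /(_ erefl); apply: filterS2 L2_fun0 => x h0 hx _.
rewrite h0//; have /eqP := hx I.
by rewrite eqe sqrf_eq0 => /eqP /ComplexField.Normc.eq0_normc.
Qed.

HB.instance Definition _ := isDotProduct.Build R[i] L2 L2dot L2dot_def.

Definition L2norm (u : L2) : R[i] := sqrtC (L2dot u u).

Let L2normD (u v : L2) : L2norm (u + v) <= L2norm u + L2norm v.
Proof. exact: dot_triangle. Qed.

Let L2normZ (a : R[i]) (u : L2) : L2norm (a *: u) = `|a| * L2norm u.
Proof.
rewrite /L2norm dnormZ sqrtCM ?nnegrE ?exprn_ge0// sqrCK//.
Qed.

Let L2norm_eq0 (u : L2) : L2norm u = 0 -> u = 0.
Proof. by move/eqP; rewrite sqrt_dnorm_eq0 => /eqP. Qed.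

HB.instance Definition _ :=
  Lmodule_isNormed.Build R[i] L2 L2normD L2normZ L2norm_eq0.

Lemma L2_normE (u : L2) : `|u| = sqrtC (L2dot u u).
Proof. by []. Qed.

Definition Linfty_fun (h : T -> R[i]) :=
  cmeasurable_fun h /\ exists M : R, \forall x \ae mu, modC (h x) <= M.

Record Linfty := LInfty { Linfty_val :> T -> R[i]; _ : Linfty_fun Linfty_val }.

Lemma LinftyP (h : Linfty) : Linfty_fun h. Proof. by case: h. Qed.

Lemma mulop_subproof (h : Linfty) (u : L2) :
  (fun x => h x * L2_fun u x) \in L2fun mu.
Proof.
have [mh [M hM]] := LinftyP h.
have mhu := cmeasurable_funM mh (cmeasurable_L2_fun u).
apply/L2funP; split => //.
have iu := L2fun_integrable (L2_fun_L2fun u).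
apply: (@le_lt_trans _ _
    (\int[mu]_x ((M ^+ 2)%:E * (modC (L2_fun u x) ^+ 2)%:E))%E).
  apply: ae_ge0_le_integral => //.
  - by move=> x _; rewrite lee_fin sqr_ge0.
  - exact: measurable_modC2.
  - by move=> x _; rewrite -EFinM lee_fin mulr_ge0 ?sqr_ge0.
  - by apply: measurable_funeM; have /integrableP[] := iu.
  apply: filterS hM => x hM _; rewrite -EFinM lee_fin.
  rewrite ComplexField.Normc.normcM exprMn ler_wpM2r ?sqr_ge0//.
  by rewrite ler_sqr ?nnegrE ?modC_ge0// (le_trans (modC_ge0 _) hM).
have /integrableP[_] : mu.-integrable [set: T]
    (fun x => (M ^+ 2)%:E * (modC (L2_fun u x) ^+ 2)%:E)%E.
  exact: integrableZl.
by under eq_integral do rewrite gee0_abs ?mule_ge0 ?lee_fin ?sqr_ge0//.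
Qed.

Definition mulop (h : Linfty) (u : L2) : L2 :=
  L2_class (L2Fun (mulop_subproof h u)).

Lemma mulop_funE (h : Linfty) (u : L2) :
  L2_fun (mulop h u) = (fun x => h x * L2_fun u x) %[ae mu].
Proof. exact: L2_fun_class. Qed.

Lemma Linfty_indic_subproof (s : set T) :
  measurable s -> Linfty_fun (fun x => (\1_s x : R)%:C).
Proof.
move=> ms; split.
  by split => /=; [exact: measurable_indic|exact: measurable_cst].
exists 1; apply: nearW => x /=.
by rewrite expr0n addr0 sqrtr_sqr ger0_norm// indicE lern1 leq_b1.
Qed.

Definition Linfty_indic (s : set T) (ms : measurable s) : Linfty :=
  LInfty (Linfty_indic_subproof ms).

End L2.

Section bohr.
Variable R : realType.

(* No continuity is required, i.e. R is discrete; the dual topology is then that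
   of pointwise convergence. *)
Definition characters : set {ptws R -> R[i]^o} :=
  [set xi | (forall x y, xi (x + y) = xi x * xi y) /\
            (forall x, `|xi x : R[i]| = 1)].

Definition bohr : Type := characters.
HB.instance Definition _ := Topological.copy bohr (set_type characters).

Definition bohr_fun (xi : bohr) : R -> R[i] := set_val xi.
Coercion bohr_fun : bohr >-> Funclass.

Lemma bohrD (xi : bohr) x y : xi (x + y) = xi x * xi y.
Proof. by have /set_mem[] := valP xi. Qed.

Lemma bohr_norm1 (xi : bohr) x : `|xi x| = 1.
Proof. by have /set_mem[] := valP xi. Qed.

Lemma bohr_neq0 (xi : bohr) x : xi x != 0.
Proof. by rewrite -normr_eq0 bohr_norm1 oner_eq0. Qed.

Lemma bohrP (xi eta : bohr) : xi =1 eta -> xi = eta.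
Proof. by move=> h; apply/val_inj/funext. Qed.

Let one_subproof : (fun _ => 1) \in characters.
Proof.
by apply/mem_set; split=> [x y|x]; rewrite ?mulr1 ?normr1.
Qed.

Let mul_subproof (xi eta : bohr) : (fun x => xi x * eta x) \in characters.
Proof.
apply/mem_set; split=> [x y|x]; first by rewrite !bohrD mulrACA.
by rewrite normrM !bohr_norm1 mulr1.
Qed.

Let inv_subproof (xi : bohr) : (fun x => (xi x)^-1) \in characters.
Proof.
apply/mem_set; split=> [x y|x]; first by rewrite bohrD invfM.
by rewrite normfV bohr_norm1 invr1.
Qed.

Let one : bohr :=
  exist (fun chi => chi \in characters) _ one_subproof.
Let mul (xi eta : bohr) : bohr :=
  exist (fun chi => chi \in characters) _ (mul_subproof xi eta).
Let inv (xi : bohr) : bohr :=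
  exist (fun chi => chi \in characters) _ (inv_subproof xi).

Let mulA : associative mul.
Proof. by move=> xi eta zeta; apply: bohrP => x; exact: mulrA. Qed.
Let mul1 : left_id one mul.
Proof. by move=> xi; apply: bohrP => x; exact: mul1r. Qed.
Let mulr1_ : right_id one mul.
Proof. by move=> xi; apply: bohrP => x; exact: mulr1. Qed.
Let mulV : left_inverse one inv mul.
Proof. by move=> xi; apply: bohrP => x; exact: mulVf (bohr_neq0 xi x). Qed.
Let mulrV_ : right_inverse one inv mul.
Proof. by move=> xi; apply: bohrP => x; exact: mulfV (bohr_neq0 xi x). Qed.

HB.instance Definition _ := isGroup.Build bohr mulA mul1 mulr1_ mulV mulrV_.

Lemma bohr_mulE (xi eta : bohr) x : (xi * eta : bohr)%g x = xi x * eta x.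
Proof. by []. Qed.

HB.instance Definition _ := isPointed.Build bohr 1%g.
HB.instance Definition _ :=
  Measurable.copy bohr (g_sigma_algebraType (@open bohr)).

Lemma bohr_eval_continuous (lambda : R) :
  continuous ((fun xi => xi lambda) : bohr -> R[i]^o).
Proof.
move=> xi; apply: (@continuous_comp _ {ptws R -> R[i]^o} _ _ (@proj R _ lambda)).
  exact: initial_continuous.
exact: proj_continuous.
Qed.

Let le_modC (f : R[i] -> R) (xi : bohr) lambda (e : R) :
  (forall z w, f (z - w) = f z - f w) -> (forall z, (`|f z|)%:C <= `|z|) ->
  0 < e -> \forall eta \near xi, `|f (xi lambda) - f (bohr_fun eta lambda)| < e.
Proof.
move=> fB fle e0; have e0C : 0 < e%:C :> R[i] by rewrite ltcR.
have /cvgrPdist_lt/(_ _ e0C) := @bohr_eval_continuous lambda xi.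
apply: filterS => eta; rewrite -fB -ltcR; exact: le_lt_trans.
Qed.

Lemma continuous_bohr_re (lambda : R) :
  continuous ((fun xi => reC (xi lambda)) : bohr -> R).
Proof.
move=> xi; apply/(@cvgrPdist_lt _ _ _ (nbhs xi) (nbhs_filter xi)) => e e0.
apply: le_modC => //.
  by move=> [a b] [c d].
by move=> z; rewrite normc_def lecR -sqrtr_sqr ler_wsqrtr// lerDl sqr_ge0.
Qed.

Lemma continuous_bohr_im (lambda : R) :
  continuous ((fun xi => imC (xi lambda)) : bohr -> R).
Proof.
move=> xi; apply/(@cvgrPdist_lt _ _ _ (nbhs xi) (nbhs_filter xi)) => e e0.
apply: le_modC => //.
  by move=> [a b] [c d].
by move=> z; rewrite normc_def lecR -sqrtr_sqr ler_wsqrtr// lerDr sqr_ge0.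
Qed.

Lemma continuous_bohr_measurable (f : bohr -> R) :
  continuous f -> measurable_fun [set: bohr] f.
Proof.
move=> /continuousP cf; apply: (measurability _ (RGenOpens.measurableE R)).
move=> _ [_ [a [b ->] <-]]; rewrite setTI; apply: sub_sigma_algebra.
exact/cf/interval_open.
Qed.

Section iota.
Variable mu : {measure set bohr -> \bar R}.

Lemma iota_e_subproof (lambda : R) :
  Linfty_fun mu (fun xi : bohr => xi lambda).
Proof.
split; first by split; apply: continuous_bohr_measurable;
  [exact: continuous_bohr_re|exact: continuous_bohr_im].
exists 1; apply: nearW => xi.
rewrite -lecR -[(modC _)%:C]/`|bohr_fun xi lambda|.
by rewrite bohr_norm1.
Qed.

(* The image of the almost periodic function x |-> exp (i lambda x) under the
   canonical isomorphism AP^2 -> L^2(bohr). *)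
Definition iota_e (lambda : R) : Linfty mu := LInfty (iota_e_subproof lambda).

End iota.

(* Borel sigma-algebra, and bohr is not metrizable: regularity is not automatic
   and is part of the definition of a Haar measure. *)
Record normalized_haar (mu : {measure set bohr -> \bar R}) : Prop := {
  haar_setT : mu [set: bohr] = 1%E;
  haar_translate : forall (xi : bohr) (A : set bohr), measurable A ->
    mu [set (xi * eta)%g | eta in A] = mu A;
  haar_outer : forall A : set bohr, measurable A ->
    mu A = ereal_inf [set mu U | U in [set U | open U /\ A `<=` U]];
  haar_inner : forall U : set bohr, open U ->
    mu U = ereal_sup [set mu K | K in [set K | compact K /\ K `<=` U]]
}.

End bohr.

(* Main.v *)
Require Import Defs.
From mathcomp Require Import all_boot all_order all_algebra.
From mathcomp Require Import all_classical all_reals all_analysis.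
From mathcomp Require Import measurable_realfun complex finmap ring lra.
Import Order.TTheory GRing.Theory Num.Def Num.Theory.
Import numFieldNormedType.Exports.
Import HBNNSimple.
Set Implicit Arguments.
Unset Strict Implicit.
Unset Printing Implicit Defensive.
Local Open Scope classical_set_scope.
Local Open Scope ring_scope.

(** Suppose first that E is invariant under the characters. A bounded
measurable real function s is called a multiplier when s E is contained in E.
Multipliers form a real algebra that is closed under bounded pointwise
limits: by dominated convergence s_n f tends to s f in L^2, and E is closed
([multiplier_lim]). It contains the real and imaginary parts of the
characters. Iterating a polynomial that converges to the sign function on
[-1, 1] gives the indicator of every set [{s > 0}] with s a multiplier
([multiplier_set_pos]), hence the indicators of a base of the topology. Open
sets are uncountable unions of basic sets, and here regularity of the Haar
measure enters: a compact subset of U is covered by finitely many basic sets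
inside U, so U agrees up to a null set with a countable union of basic sets.
Thus every Borel indicator is a multiplier ([multiplier_measurable]).

On any finite measure space, a closed subspace E for which all indicators are
multipliers is described by its support ([closed_subspace_support]). All
bounded measurable functions are multipliers, so if f is in E, so are the
functions [conj f / (|f|^2 + 1/(n+1)) * f], whose limit is the indicator of
[{f <> 0}]. The sets whose indicator is in E are stable under countable unions,
so one of them, sigma, has the largest measure; by maximality every f in E
vanishes almost everywhere off sigma, and conversely a function that vanishes
off sigma is a limit of its truncations, which are bounded multiples of the
indicator of sigma.

Uniqueness of sigma holds because the indicator of a measurable set A lies in
the range of multiplication by that of B only if A is almost contained in B.
Conversely, multiplication by a character preserves vanishing off sigma, and
the opposite character inverts it. *)

(** * Functions whose class lies in a set of L^2 *)

Lemma modC2Z (R : realType) (a : R) (z : R[i]) :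
  modC (a%:C%C * z) ^+ 2 = a ^+ 2 * modC z ^+ 2.
Proof. by rewrite ComplexField.Normc.normcM exprMn /= expr0n addr0 sqr_sqrtr ?sqr_ge0. Qed.

Lemma measurable_pos d (T : measurableType d) (R : realType) (s : T -> R) :
  measurable_fun [set: T] s -> measurable [set x | 0 < s x].
Proof.
move=> ms; have := ms measurableT `]0, +oo[%classic (measurable_itv _).
by rewrite setTI; congr measurable; apply/funext => x /=; rewrite in_itv/= andbT.
Qed.

Section L2fun_lemmas.
Context d (T : measurableType d) (R : realType).
Variable mu : {measure set T -> \bar R}.
Implicit Types f g h : T -> R[i].

Lemma L2fun_ae f g : f \in L2fun mu -> cmeasurable_fun g ->
  f = g %[ae mu] -> g \in L2fun mu.
Proof.
move=> /L2funP[mf foo] mg fg; apply/L2funP; split=> //.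
have <- : (\int[mu]_x ((modC (f x)) ^+ 2)%:E = \int[mu]_x ((modC (g x)) ^+ 2)%:E)%E.
  apply: ge0_ae_eq_integral => //; try exact: measurable_modC2.
  - by move=> x _; rewrite lee_fin sqr_ge0.
  - by move=> x _; rewrite lee_fin sqr_ge0.
  - by apply: filterS fg => x /= fg _; rewrite fg.
exact: foo.
Qed.

Lemma L2funM h f : Linfty_fun mu h -> f \in L2fun mu ->
  (fun x => h x * f x) \in L2fun mu.
Proof.
move=> hoo fL; have /L2funP[mf _] := fL; have [mh _] := hoo.
have := mulop_subproof (LInfty hoo) (L2_class (L2Fun fL)).
move=> /L2fun_ae; apply; first exact: cmeasurable_funM.
by apply: filterS (L2_fun_class (L2Fun fL)) => x /= fE _; rewrite fE.
Qed.

End L2fun_lemmas.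

Section membership.
Context d (T : measurableType d) (R : realType).
Variable mu : {measure set T -> \bar R}.
Variable E : set (L2 mu).
Implicit Types f g h : T -> R[i].

(** Working with functions rather than classes makes products and pointwise
limits available. *)
Definition L2mem f := exists fL : f \in L2fun mu, E (L2_class (L2Fun fL)).

Lemma L2mem_L2fun f : L2mem f -> f \in L2fun mu.
Proof. by case. Qed.

Lemma L2mem_cmeasurable f : L2mem f -> cmeasurable_fun f.
Proof. by case=> fL _; have /L2funP[] := fL. Qed.

Lemma L2mem_ae f g : L2mem f -> cmeasurable_fun g -> f = g %[ae mu] -> L2mem g.
Proof.
move=> [fL Ef] mg fg; have gL := L2fun_ae fL mg fg; exists gL.
by rewrite (_ : L2_class _ = L2_class (L2Fun fL))//; apply/L2_classP;
  apply: filterS fg => x /= /[apply].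
Qed.

Lemma L2mem_L2_fun u : E u <-> L2mem (L2_fun u).
Proof.
have uE : L2_class (L2Fun (L2_fun_L2fun u)) = u.
  by apply: L2_fun_inj; exact: L2_fun_class.
split=> [Eu|[uL]]; first by exists (L2_fun_L2fun u); rewrite uE.
by rewrite (_ : L2Fun uL = L2Fun (L2_fun_L2fun u)) ?uE//; exact: val_inj.
Qed.

Lemma L2mem_mulop (h : Linfty mu) u :
  E (mulop h u) <-> L2mem (fun x => h x * L2_fun u x).
Proof.
split=> [|[hL Eh]]; first by exists (mulop_subproof h u).
rewrite (_ : mulop h u = L2_class (L2Fun hL))//.
by congr L2_class; exact: val_inj.
Qed.

Hypothesis E_subspace : submod_closed (mem E).

Lemma L2memD f g : L2mem f -> L2mem g -> L2mem (fun x => f x + g x).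
Proof.
move=> [fL Ef] [gL Eg]; have fgL := rpredD fL gL; exists fgL.
have -> : L2_class (L2Fun fgL) = 1 *: L2_class (L2Fun fL) + L2_class (L2Fun gL).
  by rewrite scale1r -L2_classD; congr L2_class; exact: val_inj.
exact: set_mem (E_subspace.2 1 _ _ (mem_set Ef) (mem_set Eg)).
Qed.

Lemma L2memZ (a : R[i]) f : L2mem f -> L2mem (fun x => a * f x).
Proof.
move=> [fL Ef]; have afL := rpredZ a fL; exists afL.
have -> : L2_class (L2Fun afL) = a *: L2_class (L2Fun fL) + 0.
  by rewrite addr0 -L2_classZ; congr L2_class; exact: val_inj.
exact: set_mem (E_subspace.2 a _ _ (mem_set Ef) E_subspace.1).
Qed.

Lemma L2mem0 : L2mem (fun=> 0).
Proof.
have m0 := cmeasurable_cst T (0 : R[i]).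
apply: (L2mem_ae (f := L2_fun 0)) => //; last exact: L2_fun0.
by apply/L2mem_L2_fun; exact: set_mem E_subspace.1.
Qed.

Hypothesis E_closed : closed E.

(** The domination is on the squared differences, so that dominated convergence
gives convergence in L^2 norm at once, and E is closed. *)
Lemma L2mem_lim (f_ : nat -> T -> R[i]) f (G : T -> R) :
  (forall n, L2mem (f_ n)) -> f \in L2fun mu ->
  mu.-integrable [set: T] (EFin \o G) ->
  (forall n x, modC (f_ n x - f x) ^+ 2 <= G x) ->
  (forall x, (fun n => modC (f_ n x - f x) ^+ 2) @ \oo --> (0 : R)) ->
  L2mem f.
Proof.
move=> Ef_ fL iG fG f_f; exists fL; set u := L2_class _.
have mdiff n : cmeasurable_fun (fun x => f_ n x - f x).
  have /L2funP[mf _] := fL.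
  have := cmeasurable_funM (cmeasurable_cst _ (-1)) mf.
  move=> /(cmeasurable_funD (L2mem_cmeasurable (Ef_ n))).
  by congr cmeasurable_fun; apply/funext => x /=; rewrite mulN1r.
have /fine_cvg f_f0 :
    (\int[mu]_x (modC (f_ n x - f x) ^+ 2)%:E)%E @[n --> \oo] --> (0%:E : \bar R).
  have [|||||_ _] := @dominated_convergence _ _ _ mu _ measurableT
      (fun n x => (modC (f_ n x - f x) ^+ 2)%:E) (cst 0%E) (EFin \o G).
  - by move=> n; exact: measurable_modC2.
  - exact: measurable_cst.
  - by apply: nearW => x _; apply: cvg_EFin; [exact: nearW|exact: f_f].
  - exact: iG.
  - by apply: nearW => x n _ /=; rewrite lee_fin ger0_norm ?sqr_ge0.
  - by rewrite integral0.
suff : closure E u by move/closure_id: E_closed => <-.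
move=> B /nbhs_ballP[e /= e0 Be].
have [r r0 er] : exists2 r : R, 0 < r & e = r%:C%C.
  case: e e0 {Be} => a b; rewrite ltcE/= => /andP[/eqP /= b0 a0].
  by exists a => //; rewrite b0.
have /cvgrPdist_lt/(_ _ (exprn_gt0 2 r0)) := f_f0.
move=> [n _ /(_ n (leqnn n))].
have [f_L Ef_n] := Ef_ n; rewrite sub0r normrN /= => lt_r.
exists (L2_class (L2Fun f_L)); split=> //; apply: Be.
rewrite -ball_normE /= distrC L2_normE er.
set v := L2_class _.
have vuE : L2_fun (v - u) = (fun x => f_ n x - f x) %[ae mu].
  rewrite -scaleN1r -L2_classZ -L2_classD.
  apply: filterS (L2_fun_class (L2Fun f_L + -1 *: L2Fun fL)) => x /= -> // _.
  by rewrite -[LHS]/(f_ n x + -1 * f x) mulN1r.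
rewrite -(@ltr_sqr R[i]) ?nnegrE ?sqrtC_ge0 ?dnorm_ge0 ?lecR 1?ltW//.
rewrite sqrtCK L2dotE -rmorphXn ltcR/=; apply: le_lt_trans lt_r.
rewrite (_ : (\int[mu]_x _)%E = (\int[mu]_x (modC (f_ n x - f x) ^+ 2)%:E)%E).
  exact: ler_norm.
apply: ge0_ae_eq_integral => //.
- exact/measurable_modC2/cmeasurable_L2_fun.
- exact: measurable_modC2.
- by move=> x _; rewrite lee_fin sqr_ge0.
- by move=> x _; rewrite lee_fin sqr_ge0.
- by apply: filterS vuE => x /= vuE _; rewrite vuE.
Qed.

End membership.

(** * A polynomial iteration converging to the sign *)

Section sign_iteration.
Context {R : realType}.
Implicit Types s t : R.

(** Newton-Schulz step: an odd polynomial fixing -1, 0, 1, which moves every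
other point of [-1, 1] away from 0. *)
Definition sign_step t : R := t * (3 - t ^+ 2) / 2.

Lemma sign_stepN t : sign_step (- t) = - sign_step t.
Proof. by rewrite /sign_step sqrrN !mulNr. Qed.

Lemma sign_step_ge t : 0 <= t <= 1 -> t <= sign_step t <= 1.
Proof.
move=> /andP[t0 t1]; rewrite /sign_step; apply/andP; split.
  have : 0 <= t * (1 - t ^+ 2) by rewrite mulr_ge0// subr_ge0 expr_le1.
  lra.
have : 0 <= (1 - t) ^+ 2 * (2 + t) by rewrite mulr_ge0 ?sqr_ge0//; lra.
lra.
Qed.

Lemma norm_sign_step t : `|t| <= 1 -> `|sign_step t| <= 1.
Proof.
wlog t0 : t / 0 <= t => [H|].
  have [/H//|/ltW t0] := leP 0 t; rewrite -normrN => t1.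
  by rewrite -normrN -sign_stepN; apply: H => //; rewrite oppr_ge0.
rewrite ger0_norm// => t1.
have /andP[tt t1'] := sign_step_ge (introT andP (conj t0 t1)).
by rewrite ger0_norm// (le_trans t0).
Qed.

Lemma norm_iter_sign_step n t : `|t| <= 1 -> `|iter n sign_step t| <= 1.
Proof. by move=> t1; elim: n => //= n IH; exact: norm_sign_step. Qed.

Lemma iter_sign_stepN n t : iter n sign_step (- t) = - iter n sign_step t.
Proof. by elim: n => //= n ->; rewrite sign_stepN. Qed.

Lemma iter_sign_step_ge n t : 0 <= t <= 1 -> t <= iter n sign_step t <= 1.
Proof.
move=> t01; elim: n => [|n /= /andP[tn n1]]; first by rewrite lexx; case/andP: t01.
have n0 : 0 <= iter n sign_step t by rewrite (le_trans _ tn)//; case/andP: t01.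
have /andP[a b] := sign_step_ge (introT andP (conj n0 n1)).
by rewrite b (le_trans tn).
Qed.

(** One step multiplies the distance 1 - u by 1 - u (1 + u) / 2, and
u stays above t along the iteration, so this factor is at most 1 - t / 2. *)
Lemma iter_sign_step_rate n t : 0 <= t <= 1 ->
  1 - iter n sign_step t <= (1 - t / 2) ^+ n.
Proof.
move=> t01; have /andP[t0 t1] := t01.
elim: n => [|n IH]; first by rewrite expr0/=; lra.
have /andP[] := iter_sign_step_ge n t01; rewrite exprS iterS.
move: (iter n sign_step t) IH => u IH tu u1.
have -> : 1 - sign_step u = (1 - u * (1 + u) / 2) * (1 - u).
  by rewrite /sign_step; field.
have u0 : 0 <= u by exact: le_trans tu.
apply: ler_pM => //; [|by lra|].
  have : 0 <= (1 - u) * (2 + u) by rewrite mulr_ge0//; lra.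
  lra.
by have := mulr_ge0 u0 u0; lra.
Qed.

Lemma cvg_iter_sign_step t : `|t| <= 1 ->
  iter n sign_step t @[n --> \oo] --> Num.sg t.
Proof.
wlog t0 : t / 0 <= t => [H|].
  have [/H//|/ltW t0] := leP 0 t; rewrite -normrN => t1.
  have /cvgN : iter n sign_step (- t) @[n --> \oo] --> Num.sg (- t).
    by apply: H => //; rewrite oppr_ge0.
  rewrite sgrN opprK; apply: cvg_trans; apply: near_eq_cvg; apply: nearW => n.
  by rewrite /= !fctE iter_sign_stepN opprK.
rewrite ger0_norm// => t1; have t01 : 0 <= t <= 1 by rewrite t0.
have [<-|tn0] := eqVneq 0 t.
  rewrite sgr0 [X in X @ _](_ : _ = cst 0); first exact: cvg_cst.
  by apply/funext; elim=> //= n ->; rewrite /sign_step !mul0r.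
have tgt0 : 0 < t by rewrite lt_def eq_sym tn0.
rewrite gtr0_sg//.
have h : `|1 - t / 2| < 1 by rewrite ger0_norm; lra.
have h1 : 1 - (1 - t / 2) ^+ n @[n --> \oo] --> (1 : R).
  by rewrite -[X in _ --> X]subr0; apply: cvgB; [exact: cvg_cst|exact: cvg_expr].
apply: (squeeze_cvgr _ h1); last exact: cvg_cst.
apply: nearW => n; have := iter_sign_step_rate n t01.
have /andP[_ ->] := iter_sign_step_ge n t01.
by rewrite andbT; lra.
Qed.

End sign_iteration.

(** * Multipliers of a closed subspace *)

Section multipliers.
Context d (T : measurableType d) (R : realType).
Variable mu : {measure set T -> \bar R}.
Variable E : set (L2 mu).
Hypothesis E_subspace : submod_closed (mem E).
Hypothesis E_closed : closed E.
Implicit Types (s t : T -> R) (A B : set T).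

Definition bounded_mfun s :=
  measurable_fun [set: T] s /\ exists C : R, forall x, `|s x| <= C.

Lemma bounded_mfun_indic A : measurable A -> bounded_mfun (\1_A : T -> R).
Proof.
move=> mA; split; first exact: measurable_indic.
by exists 1 => x; rewrite indicE; case: (x \in A) => /=; rewrite ?normr1 ?normr0.
Qed.

Lemma bounded_mfun_cst (c : R) : bounded_mfun (cst c).
Proof. by split; [exact: measurable_cst|exists `|c|]. Qed.

Lemma bounded_mfun_Linfty s : bounded_mfun s ->
  Linfty_fun mu (fun x => (s x)%:C%C).
Proof.
move=> [ms [C sC]]; split; first by split=> //=; exact: measurable_cst.
by exists C; apply: nearW => x; rewrite /= expr0n addr0 sqrtr_sqr.
Qed.

(** Real-valued, so that the order and the pointwise limits are those of R;
complex functions are recovered from their real and imaginary parts because E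
is a complex subspace. *)
Definition multiplier s := bounded_mfun s /\
  forall f : T -> R[i], L2mem E f -> L2mem E (fun x => (s x)%:C%C * f x).

Definition multiplier_set A := measurable A /\ multiplier \1_A.

Lemma multiplier_cst (c : R) : multiplier (cst c).
Proof.
split; first exact: bounded_mfun_cst.
by move=> f Ef; exact: (L2memZ E_subspace c%:C%C Ef).
Qed.

Lemma multiplierD s t : multiplier s -> multiplier t ->
  multiplier (fun x => s x + t x).
Proof.
move=> [[ms [C sC]] sE] [[mt [D tD]] tE]; split.
  split; first exact: measurable_funD.
  by exists (C + D) => x; rewrite (le_trans (ler_normD _ _))// lerD.
move=> f Ef; have := L2memD E_subspace (sE _ Ef) (tE _ Ef).
by congr (L2mem E _); apply/funext => x; rewrite rmorphD mulrDl.
Qed.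

Lemma multiplierM s t : multiplier s -> multiplier t ->
  multiplier (fun x => s x * t x).
Proof.
move=> [[ms [C sC]] sE] [[mt [D tD]] tE]; split.
  split; first exact: measurable_funM.
  by exists (C * D) => x; rewrite normrM ler_pM.
move=> f Ef; have := sE _ (tE _ Ef).
by congr (L2mem E _); apply/funext => x; rewrite rmorphM mulrA.
Qed.

(** The product s_n f tends to s f in L^2, because [(2 C) ^ 2 |f| ^ 2] is
integrable and dominates [|s_n f - s f| ^ 2]. *)
Lemma multiplier_lim (s_ : nat -> T -> R) s (C : R) :
  (forall n, multiplier (s_ n)) -> (forall n x, `|s_ n x| <= C) ->
  (forall x, s_ n x @[n --> \oo] --> s x) -> multiplier s.
Proof.
move=> s_E s_C s_s.
have sC x : `|s x| <= C.
  have /cvg_norm/(@cvgr_to_le _ _ _ _ _ _ C) := s_s x.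
  by apply; apply: nearW => n; exact: s_C.
have bs : bounded_mfun s.
  split; last by exists C.
  by apply: measurable_fun_cvg => [n|x _]; [exact: (s_E n).1.1|exact: s_s].
split=> // f Ef; have fL := L2mem_L2fun Ef.
apply: (L2mem_lim E_closed (f_ := fun n x => (s_ n x)%:C%C * f x)
    (G := fun x => (2 * C) ^+ 2 * modC (f x) ^+ 2)).
- by move=> n; exact: (s_E n).2.
- by apply: L2funM fL; exact: bounded_mfun_Linfty.
- apply: (eq_integrable measurableT (fun x => ((2 * C) ^+ 2)%:E * (modC (f x) ^+ 2)%:E)%E).
    by move=> x _; rewrite -EFinM.
  by apply: integrableZl => //; exact: L2fun_integrable.
- move=> n x; rewrite -mulrBl -rmorphB ComplexField.Normc.normcM exprMn.
  rewrite ler_wpM2r ?sqr_ge0//= expr0n addr0 sqrtr_sqr ler_sqr ?nnegrE//; last first.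
    by rewrite mulr_ge0// (le_trans (normr_ge0 (s x))).
  by rewrite (le_trans (ler_normB _ _))// mulr2n mulrDl mul1r lerD.
- move=> x.
  rewrite (_ : (fun n => _) = (fun n => (s_ n x - s x) ^+ 2 * modC (f x) ^+ 2)); last first.
    apply/funext => n; rewrite -mulrBl -rmorphB ComplexField.Normc.normcM exprMn.
    by rewrite /= expr0n addr0 sqr_sqrtr ?sqr_ge0.
  rewrite -[X in _ --> X](mul0r (modC (f x) ^+ 2)); apply: cvgM; last exact: cvg_cst.
  rewrite -[X in _ --> X](mulr0 0); under eq_fun do rewrite expr2.
  have h0 : s_ n x - s x @[n --> \oo] --> (0 : R).
    by rewrite -(subrr (s x)); apply: cvgB; [exact: s_s|exact: cvg_cst].
  exact: cvgM.
Qed.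

(** Rescaled to take values in [-1, 1], s is turned into its sign by iterating a
polynomial, and the indicator of [{s > 0}] is [(sg + sg ^ 2) / 2]. *)
Lemma multiplier_set_pos s : multiplier s -> multiplier_set [set x | 0 < s x].
Proof.
move=> sE; have [[ms [C sC]] _] := sE.
split; first exact: measurable_pos.
have C1 : 0 < `|C| + 1 by rewrite ltr_wpDl.
pose t x := (`|C| + 1)^-1 * s x.
have tE : multiplier t by apply: multiplierM => //; exact: multiplier_cst.
have t1 x : `|t x| <= 1.
  rewrite /t normrM normfV (ger0_norm (ltW C1)) mulrC ler_pdivrMr// mul1r.
  by rewrite (le_trans (sC x))// (le_trans (ler_norm C))// lerDl.
have itE n : multiplier (fun x => iter n sign_step (t x)).
  elim: n => [//|n IH] /=.
  rewrite (_ : (fun x => _) = (fun x => iter n sign_step (t x) * (2^-1 *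
    (3 + (-1) * (iter n sign_step (t x) * iter n sign_step (t x)))))); last first.
    by apply/funext => x; rewrite /sign_step; ring.
  apply: (multiplierM IH); apply: multiplierM; first exact: multiplier_cst.
  apply: multiplierD; first exact: multiplier_cst.
  by apply: multiplierM; [exact: multiplier_cst|exact: multiplierM].
have sgE : multiplier (fun x => Num.sg (t x)).
  apply: (multiplier_lim (C := 1) itE) => [n x|x].
    exact: norm_iter_sign_step.
  exact: cvg_iter_sign_step.
rewrite (_ : \1__ = (fun x => 2^-1 * (Num.sg (t x) + Num.sg (t x) * Num.sg (t x)))).
  apply: multiplierM; first exact: multiplier_cst.
  by apply: multiplierD => //; exact: multiplierM.
apply/funext => x; rewrite indicE /t sgrM gtr0_sg ?invr_gt0// mul1r.
case: (ltgtP 0 (s x)) => [sx|sx|sx].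
- by rewrite mem_set//= gtr0_sg//= mulr1 mulVf.
- by rewrite memNset ?ltr0_sg//= ?mulrNN ?mulr1 ?addNr ?mulr0//; apply/negP; rewrite -leNgt ltW.
- by rewrite memNset -?sx ?sgr0 ?mul0r ?addr0 ?mulr0//= -sx ltxx.
Qed.

Lemma multiplier_setT : multiplier_set [set: T].
Proof. by split=> //; rewrite indicT; exact: multiplier_cst. Qed.

Lemma multiplier_setC A : multiplier_set A -> multiplier_set (~` A).
Proof.
move=> [mA AE]; split; first exact: measurableC.
rewrite (_ : \1__ = (fun x => 1 + (-1) * \1_A x)).
  by apply: multiplierD; [|apply: multiplierM => //]; exact: multiplier_cst.
by apply/funext => x; rewrite indicC indicE; case: (x \in A) => /=; rewrite ?mulr1 ?mulr0 ?subrr ?addr0.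
Qed.

Lemma multiplier_setI A B :
  multiplier_set A -> multiplier_set B -> multiplier_set (A `&` B).
Proof.
move=> [mA AE] [mB BE]; split; first exact: measurableI.
by rewrite indicI; exact: multiplierM.
Qed.

Lemma multiplier_setU A B :
  multiplier_set A -> multiplier_set B -> multiplier_set (A `|` B).
Proof.
move=> AE BE; rewrite -[_ `|` _]setCK setCU.
by apply/multiplier_setC/multiplier_setI; exact: multiplier_setC.
Qed.

Lemma multiplier_bigcup (A_ : nat -> set T) :
  (forall n, multiplier_set (A_ n)) -> multiplier_set (\bigcup_n A_ n).
Proof.
move=> AE; split; first by apply: bigcup_measurable => n _; exact: (AE n).1.
have UE n : multiplier_set (\big[setU/set0]_(i < n) A_ i).
  elim: n => [|n IH]; last by rewrite big_ord_recr; exact: multiplier_setU.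
  by rewrite big_ord0 -setCT; apply/multiplier_setC/multiplier_setT.
apply: (multiplier_lim (C := 1) (fun n => (UE n).2)) => [n x|x].
  by rewrite indicE; case: (_ \in _) => /=; rewrite ?normr1 ?normr0.
have [[n _ Anx]|nA] := pselect ((\bigcup_n A_ n) x).
  rewrite [X in _ --> X]indicE mem_set; last by exists n.
  apply: (@cvg_near_cst _ R^o); exists n.+1 => // m /= nm; rewrite indicE mem_set//.
  by rewrite -(bigcup_mkord m); exists n.
rewrite [X in _ --> X]indicE memNset//.
apply: (@cvg_near_cst _ R^o); apply: nearW => m; rewrite indicE memNset//.
by rewrite -(bigcup_mkord m) => -[k _ Akx]; apply: nA; exists k.
Qed.

Lemma multiplier_set_ae A B : multiplier_set A -> measurable B ->
  mu (A `+` B) = 0%E -> multiplier_set B.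
Proof.
move=> [mA [_ AE]] mB AB0; split=> //; split; first exact: bounded_mfun_indic.
move=> f Ef; apply: L2mem_ae (AE _ Ef) _ _.
  apply: cmeasurable_funM (L2mem_cmeasurable Ef); split=> /=; last exact: measurable_cst.
  exact: measurable_indic.
exists (A `+` B); split=> //.
  by apply: measurableU; exact: measurableD.
move=> x /= /existsNP[_ fx]; apply: contrapT => nAB; apply: fx.
congr (_%:C%C * _); rewrite !indicE.
have [Ax|nAx] := pselect (A x).
  rewrite !mem_set//; apply: contrapT => nBx; apply: nAB; left; split=> //.
rewrite !memNset//; apply: contra_not nAB => Bx; right; split=> //.
Qed.

End multipliers.

(** * Closed subspaces stable under all indicators *)

(** A sequence whose measures tend to the supremum has a union attaining it; the
supremum may be infinite. *)
Lemma measure_sup_attained d (T : measurableType d) (R : realType)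
    (mu : {measure set T -> \bar R}) (F : set (set T)) :
  F !=set0 -> F `<=` measurable ->
  (forall A_ : nat -> set T, (forall n, F (A_ n)) -> F (\bigcup_n A_ n)) ->
  exists2 A, F A & forall B, F B -> (mu B <= mu A)%E.
Proof.
move=> [A0 FA0] Fm FU.
have /ereal_sup_seq[u uF u_sup] : [set mu A | A in F] != set0.
  by apply/set0P; exists (mu A0), A0.
have /choice[A_ A_P] n : exists A, F A /\ mu A = u n by have [A FA <-] := uF n; exists A.
have FA : F (\bigcup_n A_ n) by apply: FU => n; exact: (A_P n).1.
exists (\bigcup_n A_ n) => // B FB.
apply: (@le_trans _ _ (ereal_sup [set mu A | A in F])).
  by apply: ereal_sup_ubound; exists B.
move/cvg_lim: (u_sup) => <- //; apply: lime_le; first by apply/cvg_ex; eexists; exact: u_sup.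
apply: nearW => n; rewrite -(A_P n).2.
by apply: le_measure; [apply/mem_set/Fm/(A_P n).1|exact/mem_set/Fm|exact: bigcup_sup].
Qed.

Section full_multipliers.
Context d (T : measurableType d) (R : realType).
Variable mu : {measure set T -> \bar R}.
Variable E : set (L2 mu).
Hypothesis E_subspace : submod_closed (mem E).
Hypothesis E_closed : closed E.
Hypothesis mu_fin : (mu [set: T] < +oo)%E.
Hypothesis E_indic : forall A, measurable A -> multiplier E \1_A.
Implicit Types (s t : T -> R) (A B : set T) (f g h : T -> R[i]).

(** The approximating simple functions lie below s, hence are uniformly
bounded. *)
Lemma multiplier_ge0 s : (forall x, 0 <= s x) -> bounded_mfun s -> multiplier E s.
Proof.
move=> s0 [ms [C sC]].
have ms' : measurable_fun [set: T] (EFin \o s) by exact/measurable_EFinP.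
have s0' x : [set: T] x -> (0 <= (EFin \o s) x)%E by rewrite /= lee_fin.
pose s_ := nnsfun_approx measurableT ms'.
have s_E n x : s_ n x <= s x by rewrite -lee_fin nnsfun_approxE; exact: le_approx.
apply: (multiplier_lim E_closed (s_ := fun n => (s_ n : T -> R)) (C := C)).
- move=> n; rewrite (funext (fimfunEord (s_ n))).
  set r := finmap.enum_fset _; elim: (size r) => [|k IH].
    by under eq_fun do rewrite big_ord0; exact: multiplier_cst.
  under eq_fun do rewrite big_ord_recr/=.
  apply: multiplierD => //; apply: multiplierM; first exact: multiplier_cst.
  exact: E_indic.
- move=> n x; rewrite ger0_norm//; first exact: le_trans (le_trans (ler_norm _) (sC x)).
- by move=> x; have /fine_cvg := cvg_nnsfun_approx measurableT ms' s0' (I : [set: T] x).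
Qed.

Lemma multiplier_bounded s : bounded_mfun s -> multiplier E s.
Proof.
move=> [ms [C sC]]; rewrite (_ : s = fun x => (s x + C) + - C); last first.
  by apply/funext => x; rewrite addrK.
apply: multiplierD; [exact: E_subspace| |exact: multiplier_cst].
apply: multiplier_ge0 => [x|].
  by have := sC x; rewrite ler_norml => /andP[+ _]; rewrite -subr_ge0 opprK.
split; first exact: measurable_funD.
by exists (C + `|C|) => x; rewrite (le_trans (ler_normD _ _))// lerD.
Qed.

Lemma L2memM h f : bounded_mfun (fun x => reC (h x)) ->
  bounded_mfun (fun x => imC (h x)) -> L2mem E f -> L2mem E (fun x => h x * f x).
Proof.
move=> /multiplier_bounded[_ reE] /multiplier_bounded[_ imE] Ef.
have := L2memD E_subspace (reE _ Ef) (L2memZ E_subspace 'i%C (imE _ Ef)).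
congr (L2mem E _); apply/funext => x; rewrite mulrA -mulrDl; congr (_ * _).
by case: (h x) => a b; apply/eqP; rewrite eq_complex /=; apply/andP; split; apply/eqP; ring.
Qed.

Lemma bounded_mfun_L2fun h : bounded_mfun (fun x => reC (h x)) ->
  bounded_mfun (fun x => imC (h x)) -> h \in L2fun mu.
Proof.
move=> [mr [C rC]] [mi [D iD]]; apply/L2funP; split=> //.
apply: (@le_lt_trans _ _ (\int[mu]_x (C ^+ 2 + D ^+ 2)%:E)%E).
  apply: ge0_le_integral => //.
  - by move=> x _; rewrite lee_fin sqr_ge0.
  - exact: measurable_modC2.
  - move=> x _; rewrite lee_fin modC2 -(real_normK (num_real (reC _))).
    rewrite -(real_normK (num_real (imC _))) lerD// ler_sqr ?nnegrE//.
      exact: le_trans (rC x).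
    exact: le_trans (iD x).
rewrite integral_cst//; apply: lte_mul_pinfty => //.
by rewrite lee_fin addr_ge0 ?sqr_ge0.
Qed.

(** The indicator of [{f <> 0}] is the pointwise limit of
[|f|^2 / (|f|^2 + 1/(n+1))], which is f times the bounded function
[conj f / (|f|^2 + 1/(n+1))]. *)
Lemma L2mem_support f : L2mem E f ->
  L2mem E (fun x => (\1_[set x | 0 < modC (f x) ^+ 2] x)%:C%C).
Proof.
move=> Ef; have [mr mi] := L2mem_cmeasurable Ef.
pose u x : R := modC (f x) ^+ 2.
have u0 x : 0 <= u x by exact: sqr_ge0.
have mu_ : measurable_fun [set: T] u.
  by apply/measurable_EFinP; exact: measurable_modC2.
have ms : measurable [set x | 0 < u x] by exact: measurable_pos.
pose e n : R := n.+1%:R^-1.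
have e0 n : 0 < e n by rewrite invr_gt0.
pose k n x : R := (u x + e n)^-1.
have ue0 n x : 0 < u x + e n by rewrite ltr_wpDl.
have mk n : measurable_fun [set: T] (k n).
  (* measurability of the inverse comes from that of real powers *)
  rewrite (_ : k n = (@powR R ^~ (-1)) \o (fun x => u x + e n)).
    apply: measurableT_comp; first exact: measurable_powR.
    exact: measurable_funD.
  by apply/funext => x /=; rewrite powR_inv1// ltW.
(* [|a| <= a ^ 2 + 1 <= (n + 1) (u + 1 / (n + 1))] *)
have k_le n x (a : R) : a ^+ 2 <= u x -> `|a * k n x| <= n.+1%:R.
  move=> au; rewrite normrM normfV (gtr0_norm (ue0 n x)) ler_pdivrMr//.
  rewrite mulrDr /e divff ?pnatr_eq0//.
  have a1 : `|a| <= a ^+ 2 + 1.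
    by rewrite -real_normK ?num_real//; have := sqr_ge0 (`|a| - 1); nra.
  rewrite (le_trans a1)// lerD2r (le_trans au)// ler_peMl//.
  by rewrite ler1n.
have uE x : u x = reC (f x) ^+ 2 + imC (f x) ^+ 2 by exact: modC2.
have kfE n : L2mem E (fun x => (u x * k n x)%:C%C).
  have : L2mem E (fun x => ((f x)^*%R * (k n x)%:C%C) * f x).
    apply: L2memM => //.
      split; last first.
        exists n.+1%:R => x; rewrite reCM/= mulr0 subr0 reCJ.
        by apply: k_le; rewrite uE lerDl sqr_ge0.
      under eq_fun do rewrite reCM/= mulr0 subr0 reCJ.
      exact: measurable_funM.
    split; last first.
      exists n.+1%:R => x; rewrite imCM/= mulr0 add0r imCJ mulNr normrN.
      by apply: k_le; rewrite uE lerDr sqr_ge0.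
    under eq_fun do rewrite imCM/= mulr0 add0r imCJ.
    by apply: measurable_funM => //; exact: measurable_funN.
  congr (L2mem E _); apply/funext => x; rewrite mulrAC -mulrA mulrCA mulrC uE.
  case: (f x) => a b; apply/eqP; rewrite eq_complex /=.
  by apply/andP; split; apply/eqP; ring.
have k1 n x : 0 <= u x * k n x <= 1.
  by rewrite mulr_ge0 ?invr_ge0 ?(ltW (ue0 n x))// ler_pdivrMr// mul1r lerDl ltW.
apply: (L2mem_lim E_closed kfE (G := cst 1)).
- by apply: bounded_mfun_L2fun => /=; [exact: bounded_mfun_indic|exact: bounded_mfun_cst].
- apply/integrableP; split; first exact/measurable_EFinP/measurable_cst.
  by under eq_integral do rewrite /= normr1; rewrite integral_cst// mul1e.
- move=> n x; rewrite -rmorphB /= expr0n addr0 sqr_sqrtr ?sqr_ge0//.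
  have /andP[a b] := k1 n x.
  rewrite -(real_normK (num_real _)) expr_le1// indicE.
  by case: (_ \in _) => /=; rewrite ler_norml; lra.
- move=> x; rewrite (_ : (fun n => _) =
      (fun n => (u x * k n x - \1_[set x | 0 < u x] x) ^+ 2)); last first.
    by apply/funext => n; rewrite -rmorphB /= expr0n addr0 sqr_sqrtr ?sqr_ge0.
  have h0 : u x * k n x - \1_[set x | 0 < u x] x @[n --> \oo] --> (0 : R).
    have [ux|] := ltP 0 (u x); last first.
      move=> ux; have {}ux : u x = 0 by apply/eqP; rewrite eq_le ux u0.
      rewrite [X in X @ _](_ : _ = cst 0); first exact: cvg_cst.
      by apply/funext => n; rewrite ux mul0r indicE memNset ?subrr//= ux ltxx.
    rewrite indicE mem_set//= -[X in _ --> X](subrr 1); apply: cvgB; last exact: cvg_cst.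
    rewrite -[X in _ --> X](divff (lt0r_neq0 ux)); apply: cvgM; first exact: cvg_cst.
    apply: cvgV; first exact: lt0r_neq0.
    rewrite -[X in _ --> X]addr0; apply: cvgD; first exact: cvg_cst.
    exact: cvg_harmonic.
  rewrite -[X in _ --> X](mulr0 0); under eq_fun do rewrite expr2.
  exact: cvgM.
Qed.

Definition L2mem_set A := measurable A /\ L2mem E (fun x => (\1_A x)%:C%C).

Lemma L2mem_set0 : L2mem_set set0.
Proof.
split=> //; rewrite indic0; exact: L2mem0.
Qed.

(** The indicator of the union of A and B is [1_A + 1_(~ A) 1_B], and [1_(~ A)] is
a multiplier. *)
Lemma L2mem_setU A B : L2mem_set A -> L2mem_set B -> L2mem_set (A `|` B).
Proof.
move=> [mA EA] [mB EB]; split; first exact: measurableU.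
have := L2memD E_subspace EA ((E_indic (measurableC mA)).2 _ EB).
congr (L2mem E _); apply/funext => x; rewrite -rmorphM -rmorphD; congr (_%:C%C).
rewrite indicC !indicE in_setU.
by case: (x \in A); case: (x \in B) => /=; rewrite ?mulr0 ?mul0r ?mulr1 ?addr0 ?add0r.
Qed.

Lemma L2mem_bigcup (A_ : nat -> set T) :
  (forall n, L2mem_set (A_ n)) -> L2mem_set (\bigcup_n A_ n).
Proof.
move=> AE; have mA : measurable (\bigcup_n A_ n).
  by apply: bigcup_measurable => n _; exact: (AE n).1.
split=> //.
have UE n : L2mem_set (\big[setU/set0]_(i < n) A_ i).
  elim: n => [|n IH]; last by rewrite big_ord_recr; exact: L2mem_setU.
  by rewrite big_ord0; exact: L2mem_set0.
apply: (L2mem_lim E_closed (fun n => (UE n).2) (G := cst 1)).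
- by apply: bounded_mfun_L2fun => //=; [exact: bounded_mfun_indic|exact: bounded_mfun_cst].
- apply/integrableP; split; first exact/measurable_EFinP/measurable_cst.
  by under eq_integral do rewrite /= normr1; rewrite integral_cst// mul1e.
- move=> n x; rewrite -rmorphB /= expr0n addr0 sqr_sqrtr ?sqr_ge0//.
move=> x; apply: (@cvg_near_cst _ R^o).
suff [N hN] : exists N, forall m, (N <= m)%N ->
    (x \in \big[setU/set0]_(i < m) A_ i) = (x \in \bigcup_n A_ n).
  by exists N => // m Nm; rewrite !indicE (hN _ Nm) subrr ComplexField.Normc.normc0 expr0n.
have [[n _ Anx]|nA] := pselect ((\bigcup_n A_ n) x).
  exists n.+1 => m nm; rewrite [RHS]mem_set; last by exists n.
  by rewrite mem_set// -(bigcup_mkord m); exists n.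
exists 0%N => m _; rewrite [RHS]memNset// memNset//.
by rewrite -(bigcup_mkord m) => -[k _ Akx]; apply: nA; exists k.
Qed.

(** On [{|g|^2 <= n}] the function g is bounded, so its product with the indicator
of A is in E; the truncations converge to g, dominated by [|g|^2]. *)
Lemma L2mem_supported A g : L2mem_set A -> g \in L2fun mu ->
  {ae mu, forall x, ~ A x -> g x = 0} -> L2mem E g.
Proof.
move=> [mA EA] gL gA; have /L2funP[mg _] := gL; have [mr mi] := mg.
pose u x : R := modC (g x) ^+ 2.
have mu_ : measurable_fun [set: T] u.
  by apply/measurable_EFinP; exact: measurable_modC2.
pose B n := [set x | u x <= n%:R].
have mB n : measurable (B n).
  have := mu_ measurableT `]-oo, n%:R]%classic (measurable_itv _).
  by rewrite setTI; congr measurable; apply/funext => x /=; rewrite in_itv/=.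
(* on B n a component a satisfies [|a| <= a ^ 2 + 1 <= n + 1] *)
have gB n x : `|\1_(B n) x * reC (g x)| <= n%:R + 1 /\
    `|\1_(B n) x * imC (g x)| <= n%:R + 1.
  rewrite indicE; have [/set_mem|_] := boolP (x \in B n); last first.
    by rewrite !mul0r normr0.
  rewrite /B/= /u modC2 !mul1r; move: (reC _) (imC _) => a b ab.
  have := sqr_ge0 (`|a| - 1); have := sqr_ge0 (`|b| - 1).
  have := sqr_ge0 a; have := sqr_ge0 b.
  rewrite -(real_normK (num_real a)) -(real_normK (num_real b)) in ab *.
  by move=> *; split; nra.
have gnE n : L2mem E (fun x => ((\1_(B n) x)%:C%C * g x) * (\1_A x)%:C%C).
  apply: L2memM => //.
    split; last by exists (n%:R + 1) => x; rewrite reCM/= mul0r subr0; have [] := gB n x.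
    under eq_fun do rewrite reCM/= mul0r subr0.
    by apply: measurable_funM => //; exact: measurable_indic.
  split; last by exists (n%:R + 1) => x; rewrite imCM/= mul0r addr0; have [] := gB n x.
  under eq_fun do rewrite imCM/= mul0r addr0.
  by apply: measurable_funM => //; exact: measurable_indic.
have gAL : (fun x => g x * (\1_A x)%:C%C) \in L2fun mu.
  under eq_fun do rewrite mulrC.
  exact: L2funM (bounded_mfun_Linfty mu (bounded_mfun_indic R mA)) gL.
have /L2funP[mgA _] := gAL.
have gE : L2mem E (fun x => g x * (\1_A x)%:C%C).
  have diffE n x :
      modC ((\1_(B n) x)%:C%C * g x * (\1_A x)%:C%C - g x * (\1_A x)%:C%C) ^+ 2
      = ((\1_(B n) x - 1) * \1_A x) ^+ 2 * u x.
    rewrite -modC2Z rmorphM rmorphB rmorph1; congr (modC _ ^+ 2); ring.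
  apply: (L2mem_lim E_closed gnE gAL (G := u)).
  - exact: L2fun_integrable.
  - move=> n x; rewrite diffE ler_piMl ?sqr_ge0// !indicE.
    case: (x \in B n); case: (x \in A) => /=; lra.
  move=> x; apply: (@cvg_near_cst _ R^o).
  exists (Num.bound (u x)) => // n /= un.
  rewrite diffE indicE mem_set ?subrr ?mul0r ?expr0n ?mul0r//.
  have /ltW := archi_boundP (sqr_ge0 (modC (g x))).
  by move=> /le_trans; apply; rewrite ler_nat.
apply: L2mem_ae gE mg _; apply: filterS gA => x gA _.
rewrite indicE; have [|/negP nA] := boolP (x \in A); first by rewrite mulr1.
by rewrite mulr0 gA// => /mem_set.
Qed.

(** The support is a set of largest measure among those with indicator in E:
adjoining [{f <> 0}] to it, for f in E, cannot increase the measure. *)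
Lemma closed_subspace_support : exists2 A, measurable A &
  forall f, f \in L2fun mu ->
    L2mem E f <-> {ae mu, forall x, ~ A x -> f x = 0}.
Proof.
have [||A AE A_max] := @measure_sup_attained _ _ _ mu L2mem_set _ _ L2mem_bigcup.
  by exists set0; exact: L2mem_set0.
  by move=> A [].
exists A; first exact: AE.1; move=> f fL; split; last exact: L2mem_supported.
move=> Ef; have BE := L2mem_support Ef.
set B := [set x | _] in BE.
have mB : measurable B.
  have /L2funP[/measurable_modC2/measurable_EFinP mf _] := fL.
  exact: measurable_pos.
have [mA _] := AE.
have muA : mu A \is a fin_num.
  rewrite ge0_fin_numE//; apply: le_lt_trans mu_fin.
  by apply: le_measure => //; exact: mem_set.
have BA0 : mu (B `\` A) = 0%E.
  have := A_max _ (L2mem_setU AE (conj mB BE)).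
  have -> : A `|` B = A `|` (B `\` A).
    by apply/seteqP; split=> x [|]; have [] := pselect (A x); rewrite /setD/=; tauto.
  rewrite measureU//; [|exact: measurableD|by apply/seteqP; split=> x // -[Ax [_]]].
  rewrite -leeBrDl// subee// => BA.
  by apply/eqP; rewrite eq_le BA measure_ge0.
exists (B `\` A); split=> //; first exact: measurableD.
move=> x /= /not_implyP[nAx fx]; split=> //.
rewrite /B/= lt_def sqr_ge0 andbT sqrf_eq0.
by apply: contra_notN fx => /eqP /ComplexField.Normc.eq0_normc.
Qed.

End full_multipliers.

(** * Multiplication by an indicator *)

Section indicator_range.
Context d (T : measurableType d) (R : realType).
Variable mu : {measure set T -> \bar R}.
Hypothesis mu_fin : (mu [set: T] < +oo)%E.

Lemma indicator_rangeP (A : set T) (mA : measurable A) (u : L2 mu) :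
  (mulop (Linfty_indic mu mA) @` [set: L2 mu]) u <->
  {ae mu, forall x, ~ A x -> L2_fun u x = 0}.
Proof.
split=> [[v _ <-]|uA].
  apply: filterS (mulop_funE (Linfty_indic mu mA) v) => x /= -> // nAx.
  by rewrite indicE memNset//= mul0r.
exists u => //; apply: L2_fun_inj.
apply: filterS2 uA (mulop_funE (Linfty_indic mu mA) u) => x /= uA -> // _.
rewrite indicE; have [|/negP nA] := boolP (x \in A); first by rewrite mul1r.
by rewrite mul0r uA// => /mem_set.
Qed.

(** The indicator of A is in the first range, and is nonzero on A. *)
Lemma indicator_range_subset (A B : set T) (mA : measurable A) (mB : measurable B) :
  mulop (Linfty_indic mu mA) @` [set: L2 mu] `<=`
  mulop (Linfty_indic mu mB) @` [set: L2 mu] -> mu (A `\` B) = 0%E.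
Proof.
move=> AB; have b1 := bounded_mfun_indic R mA.
have AL : (fun x => (\1_A x : R)%:C%C) \in L2fun mu.
  by apply: bounded_mfun_L2fun => //=; exact: bounded_mfun_cst.
have : (mulop (Linfty_indic mu mA) @` [set: L2 mu]) (L2_class (L2Fun AL)).
  apply/indicator_rangeP; apply: filterS (L2_fun_class (L2Fun AL)) => x /= -> // nAx.
  by rewrite indicE memNset.
move=> /AB/indicator_rangeP AB0; apply/negligibleP; first exact: measurableD.
have nAB : {ae mu, forall x, ~ (A `\` B) x}.
  apply: filterS2 AB0 (L2_fun_class (L2Fun AL)) => x /= uB uA [Ax nBx].
  move: (uB nBx); rewrite uA// indicE mem_set//= => /eqP.
  by rewrite eq_complex/= oner_eq0.
by apply: negligibleS nAB => x ABx /=; exact.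
Qed.

End indicator_range.

(** * Characters and Borel sets of the Bohr compactification *)

Lemma bohr_sqr_norm1 (R : realType) (xi : bohr R) x :
  reC (xi x) ^+ 2 + imC (xi x) ^+ 2 = 1.
Proof.
have /eqP := bohr_norm1 xi x; rewrite normc_def eq_complex/= eqxx andbT => /eqP h.
by rewrite -[LHS]sqr_sqrtr ?addr_ge0 ?sqr_ge0// h expr1n.
Qed.

Lemma bohrN (R : realType) (xi : bohr R) x :
  xi (- x) = (reC (xi x) +i* (- imC (xi x)))%C.
Proof.
have xi0 : xi 0 = 1.
  by apply: (mulIf (bohr_neq0 xi 0)); rewrite mul1r -bohrD addr0.
have := bohrD xi x (- x); rewrite subrr xi0.
have := bohr_sqr_norm1 xi x; case: (xi x) (xi (- x)) => a b [c e] /= ab /eqP.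
rewrite eq_complex/= => /andP[/eqP h1 /eqP h2].
apply/eqP; rewrite eq_complex/=; apply/andP; split; apply/eqP.
  have : c * (a ^+ 2 + b ^+ 2) = a * (a * c - b * e) + b * (a * e + b * c) by ring.
  by rewrite ab -h1 -h2 !mulr1 mulr0 addr0.
have : e * (a ^+ 2 + b ^+ 2) = a * (a * e + b * c) - b * (a * c - b * e) by ring.
by rewrite ab -h1 -h2 !mulr1 mulr0 sub0r.
Qed.

(** Makes compact sets closed, hence measurable, so that inner regularity can be
combined with monotonicity of the measure.  *)
Lemma bohr_hausdorff (R : realType) : hausdorff_space (bohr R).
Proof.
move=> p q pq.
have sep (f : bohr R -> R) : continuous f -> f p = f q.
  move=> cf; apply: Rhausdorff => A B /(cf p) pA /(cf q) qB.
  by have [x [Ax Bx]] := pq _ _ pA qB; exists (f x).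
apply: bohrP => x; apply/eqP; rewrite eq_complex.
by rewrite (sep _ (@continuous_bohr_re R x)) (sep _ (@continuous_bohr_im R x)) !eqxx.
Qed.

Section bohr_multipliers.
Variables (R : realType) (mu : {measure set (bohr R) -> \bar R}).
Variable E : set (L2 mu).
Hypothesis mu_haar : normalized_haar mu.
Hypothesis E_subspace : submod_closed (mem E).
Hypothesis E_closed : closed E.
Hypothesis E_char : forall (lambda : R) (f : bohr R -> R[i]),
  L2mem E f -> L2mem E (fun xi : bohr R => xi lambda * f xi).

Lemma multiplier_bohr_re lambda : multiplier E (fun xi : bohr R => reC (xi lambda)).
Proof.
split.
  split; first by apply: continuous_bohr_measurable; exact: continuous_bohr_re.
  exists 1 => xi; rewrite -(@expr_le1 _ 2)// real_normK ?num_real//.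
  by rewrite -(bohr_sqr_norm1 xi lambda) lerDl sqr_ge0.
move=> f Ef.
have := L2memZ E_subspace (2^-1) (L2memD E_subspace (E_char lambda Ef) (E_char (- lambda) Ef)).
congr (L2mem E _); apply/funext => xi; rewrite -mulrDl mulrA bohrN; congr (_ * _).
case: (bohr_fun xi lambda) => a b; apply: (@mulfI _ 2); first by rewrite pnatr_eq0.
rewrite mulrA divff ?pnatr_eq0// mul1r mulr2n mulrDl mul1r.
by apply/eqP; rewrite eq_complex/= subrr addr0 !eqxx.
Qed.

Lemma multiplier_bohr_im lambda : multiplier E (fun xi : bohr R => imC (xi lambda)).
Proof.
split.
  split; first by apply: continuous_bohr_measurable; exact: continuous_bohr_im.
  exists 1 => xi; rewrite -(@expr_le1 _ 2)// real_normK ?num_real//.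
  by rewrite -(bohr_sqr_norm1 xi lambda) lerDr sqr_ge0.
move=> f Ef.
have := L2memD E_subspace
  (L2memZ E_subspace (0 +i* (- 2^-1))%C (E_char lambda Ef))
  (L2memZ E_subspace (0 +i* 2^-1)%C (E_char (- lambda) Ef)).
congr (L2mem E _); apply/funext => xi; rewrite !mulrA -mulrDl bohrN; congr (_ * _).
case: (bohr_fun xi lambda) => a b; apply/eqP; rewrite eq_complex/=.
by apply/andP; split; apply/eqP; lra.
Qed.

Definition bohr_tube (xi : bohr R) (lambda r : R) : set (bohr R) :=
  [set eta | modC (bohr_fun eta lambda - xi lambda) ^+ 2 < r].

Definition open_multiplier_set (A : set (bohr R)) := open A /\ multiplier_set E A.

Lemma bohr_tube_open_multiplier xi lambda r : open_multiplier_set (bohr_tube xi lambda r).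
Proof.
(* the tube is the positivity set of an element of the algebra of multipliers *)
have -> : bohr_tube xi lambda r = [set eta | 0 < r + (-1) *
    ((reC (bohr_fun eta lambda) + - reC (xi lambda)) *
     (reC (bohr_fun eta lambda) + - reC (xi lambda)) +
     (imC (bohr_fun eta lambda) + - imC (xi lambda)) *
     (imC (bohr_fun eta lambda) + - imC (xi lambda)))].
  apply/funext => eta; rewrite /bohr_tube/= modC2 reCD imCD mulN1r subr_gt0 !expr2.
  by case: (xi lambda).
split.
  apply: (@open_comp _ _ (fun eta : bohr R => _ : R) [set t : R | 0 < t]) => [eta _|].
    have FF : Filter (nbhs eta) := nbhs_filter eta.
    apply: cvgD; first exact: cvg_cst.
    apply: cvgM; first exact: cvg_cst.
    have hr : reC (bohr_fun x lambda) + - reC (xi lambda) @[x --> eta] -->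
         reC (bohr_fun eta lambda) + - reC (xi lambda).
      by apply: cvgD; [exact: continuous_bohr_re|exact: cvg_cst].
    have hi : imC (bohr_fun x lambda) + - imC (xi lambda) @[x --> eta] -->
         imC (bohr_fun eta lambda) + - imC (xi lambda).
      by apply: cvgD; [exact: continuous_bohr_im|exact: cvg_cst].
    by apply: cvgD; exact: cvgM.
  exact: open_gt.
apply: multiplier_set_pos => //; apply: multiplierD => //; first exact: multiplier_cst.
apply: multiplierM; first exact: multiplier_cst.
have hr : multiplier E (fun eta : bohr R => reC (eta lambda) + - reC (xi lambda)).
  exact: (multiplierD E_subspace (multiplier_bohr_re lambda)
    (multiplier_cst E_subspace (- reC (bohr_fun xi lambda)))).
have hi : multiplier E (fun eta : bohr R => imC (eta lambda) + - imC (xi lambda)).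
  exact: (multiplierD E_subspace (multiplier_bohr_im lambda)
    (multiplier_cst E_subspace (- imC (bohr_fun xi lambda)))).
by apply: multiplierD => //; exact: multiplierM.
Qed.

(** The open sets around xi whose indicator is a multiplier form a filter base;
since it contains the tubes, its filter converges pointwise to xi, so it is finer
than the neighbourhood filter. *)
Lemma bohr_basis (U : set (bohr R)) xi : open U -> U xi ->
  exists2 A, open_multiplier_set A & A xi /\ A `<=` U.
Proof.
move=> [W oW WU] Uxi.
pose F : set_system {ptws R -> R[i]^o} :=
  [set V | exists2 A, open_multiplier_set A & A xi /\ forall eta, A eta -> V (bohr_fun eta)].
have FF : Filter F.
  split.
  - exists setT; last by [].
    by split; [exact: openT|exact: multiplier_setT].
  - move=> P Q [A [oA AE] [Axi AP]] [B [oB BE] [Bxi BQ]]; exists (A `&` B).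
      by split; [exact: openI|exact: multiplier_setI].
    by split=> // eta [/AP ? /BQ ?].
  - by move=> P Q PQ [A gA [Axi AP]]; exists A => //; split=> // eta /AP; exact: PQ.
have : F --> (bohr_fun xi : {ptws R -> R[i]^o}).
  apply/pointwise_cvgP => lambda V /nbhs_ballP[e /= e0 eV].
  case: e e0 eV => r b; rewrite ltcE/= => /andP[/eqP-> r0] eV.
  exists (bohr_tube xi lambda (r ^+ 2)); first exact: bohr_tube_open_multiplier.
  split; first by rewrite /bohr_tube/= subrr ComplexField.Normc.normc0 expr0n exprn_gt0.
  move=> eta; rewrite /bohr_tube/= => h; apply: eV.
  rewrite /ball/= distrC -[ltLHS]/((modC _)%:C%C) ltcR.
  by rewrite -ltr_sqr ?nnegrE ?modC_ge0 ?(ltW r0).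
move=> /(_ W)[].
  by apply: open_nbhs_nbhs; split=> //; move: Uxi; rewrite -WU.
by move=> A gA [Axi AW]; exists A => //; split=> // eta /AW; rewrite -WU.
Qed.

Lemma compact_open_multiplier_cover (U K : set (bohr R)) : open U -> compact K -> K `<=` U ->
  exists2 V, open_multiplier_set V & K `<=` V /\ V `<=` U.
Proof.
move=> oU; rewrite compact_cover => cK KU.
have [||D DU KD] := cK _ [set A | open_multiplier_set A /\ A `<=` U] id.
- by move=> A [[]].
- move=> xi /KU/(bohr_basis oU)[A gA [Axi AU]]; exists A => //; split=> //.
exists (cover [set` D] id); last first.
  by split=> // xi [A /DU/set_mem[_ AU]]; exact: AU.
rewrite /cover bigcup_fset big_seq; elim/big_ind: _ => [|A B [oA AE] [oB BE]|A /DU/set_mem[]//].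
  split; first exact: open0.
  by rewrite -setCT; apply: multiplier_setC => //; exact: multiplier_setT.
by split; [exact: openU|exact: multiplier_setU].
Qed.

(** Among the subsets of U whose indicator is a multiplier, take one of largest
measure. By inner regularity and the previous covering lemma its measure is that
of U, so it differs from U by a null set. *)
Lemma multiplier_set_open (U : set (bohr R)) : open U -> multiplier_set E U.
Proof.
move=> oU; have [mu1 _ _ mu_inner] := mu_haar.
have mo (A : set (bohr R)) : open A -> measurable A by exact: sub_sigma_algebra.
have [||V [VE VU] Vmax] := @measure_sup_attained _ _ _ mu
  [set V | multiplier_set E V /\ V `<=` U] _ _ (fun A_ AE => conj
    (multiplier_bigcup E_subspace E_closed (fun n => (AE n).1))
    (bigcup_sub (fun n _ => (AE n).2))).
  exists set0; split=> //; rewrite -setCT; apply: multiplier_setC => //.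
  exact: multiplier_setT.
  by move=> A [[]].
apply: (multiplier_set_ae VE (mo _ oU)).
have -> : V `+` U = U `\` V by rewrite /setY (_ : V `\` U = set0) ?set0U//; rewrite setD_eq0.
have muV : mu V = mu U.
  apply/eqP; rewrite eq_le; apply/andP; split.
    by apply: le_measure => //; apply: mem_set; [exact: VE.1|exact: mo].
  rewrite (mu_inner _ oU); apply: ge_ereal_sup => _ [K [cK KU] <-].
  have [A [oA AE] [KA AU]] := compact_open_multiplier_cover oU cK KU.
  apply: le_trans (Vmax A (conj AE AU)); apply: le_measure => //; apply: mem_set; last exact: mo.
  rewrite -[K]setCK; apply: measurableC; apply: mo; apply: closed_openC.
  by apply: compact_closed => //; exact: bohr_hausdorff.
have muU : (mu U < +oo)%E.
  apply: (@le_lt_trans _ _ (mu [set: bohr R])); last by rewrite mu1 ltry.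
  by apply: le_measure => //; apply: mem_set; [exact: mo|exact: measurableT].
have mV : measurable V by exact: VE.1.
rewrite (measureD (mo _ oU) mV muU) setIC (setIidl VU).
rewrite [X in (_ - X)%E]muV subee//.
by rewrite ge0_fin_numE.
Qed.

Lemma multiplier_measurable (A : set (bohr R)) : measurable A -> multiplier E \1_A.
Proof.
move=> mA; suff [] : multiplier_set E A by [].
move: A mA; apply: smallest_sub; last by move=> U /multiplier_set_open.
split.
- by rewrite -setCT; apply: multiplier_setC => //; exact: multiplier_setT.
- by move=> A AE; rewrite setTD; exact: multiplier_setC.
- by move=> A_ AE; exact: multiplier_bigcup.
Qed.

End bohr_multipliers.

Theorem theorem3p1 (R : realType) (mu : {measure set (bohr R) -> \bar R})
    (mu_haar : normalized_haar mu) (E : set (L2 mu))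
    (E_subspace : submod_closed (mem E)) (E_closed : closed E) :
  (forall lambda : R, mulop (iota_e mu lambda) @` E = E) <->
  exists (sigma : set (bohr R)) (msigma : measurable sigma),
    [/\ E = mulop (Linfty_indic mu msigma) @` [set: L2 mu],
        mulop (Linfty_indic mu msigma) @` [set: L2 mu] =
          [set f : L2 mu | {ae mu, forall xi, ~ sigma xi -> L2_fun f xi = 0}] &
        forall (tau : set (bohr R)) (mtau : measurable tau),
          E = mulop (Linfty_indic mu mtau) @` [set: L2 mu] ->
          mu (sigma `+` tau) = 0%E].
Proof.
have mu_fin : (mu [set: bohr R] < +oo)%E by rewrite (haar_setT mu_haar) ltry.
split=> [E_inv|[sigma [msigma [E_sigma _ _]]] lambda].
  have E_char (lambda : R) (f : bohr R -> R[i]) :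
      L2mem E f -> L2mem E (fun xi : bohr R => xi lambda * f xi).
    move=> Ef; have [fL EfL] := Ef.
    have : E (mulop (iota_e mu lambda) (L2_class (L2Fun fL))).
      by rewrite -(E_inv lambda); exists (L2_class (L2Fun fL)).
    move=> /L2mem_mulop /L2mem_ae; apply.
      apply: cmeasurable_funM (L2mem_cmeasurable Ef).
      by have [] := iota_e_subproof mu lambda.
    by apply: filterS (L2_fun_class (L2Fun fL)) => xi /= fE _; rewrite fE.
  have [sigma msigma sigmaP] := closed_subspace_support E_subspace E_closed mu_fin
    (multiplier_measurable mu_haar E_subspace E_closed E_char).
  have E_sigma : E = mulop (Linfty_indic mu msigma) @` [set: L2 mu].
    apply/seteqP; split=> u.
      by move=> /L2mem_L2_fun/sigmaP uE; apply/indicator_rangeP/uE/L2_fun_L2fun.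
    by move=> /indicator_rangeP uE; apply/L2mem_L2_fun/sigmaP => //; exact: L2_fun_L2fun.
  exists sigma, msigma; split=> //.
    by apply/seteqP; split=> u /indicator_rangeP.
  move=> tau mtau E_tau; rewrite /setY measureU//; first last.
  - by apply/seteqP; split=> xi // -[[? ?] [? ?]].
  - exact: measurableD.
  - exact: measurableD.
  have st0 : mu (sigma `\` tau) = 0%E.
    have := @indicator_range_subset _ _ _ mu mu_fin _ _ msigma mtau.
    by rewrite -E_sigma -E_tau; apply.
  have ts0 : mu (tau `\` sigma) = 0%E.
    have := @indicator_range_subset _ _ _ mu mu_fin _ _ mtau msigma.
    by rewrite -E_sigma -E_tau; apply.
  by rewrite [X in (X + _)%E]st0 [X in (_ + X)%E]ts0 adde0.
have EP u : E u <-> {ae mu, forall xi, ~ sigma xi -> L2_fun u xi = 0}.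
  by rewrite {1}E_sigma; exact: indicator_rangeP.
have E_char kappa u : E u -> E (mulop (iota_e mu kappa) u).
  move=> /EP uE; apply/EP.
  apply: filterS2 uE (mulop_funE (iota_e mu kappa) u) => xi /= uE -> // nsxi.
  by rewrite uE// mulr0.
apply/seteqP; split=> [_ [u Eu <-]|u Eu]; first exact: E_char.
exists (mulop (iota_e mu (- lambda)) u); first exact: E_char.
apply: L2_fun_inj; apply: filterS2
  (mulop_funE (iota_e mu lambda) (mulop (iota_e mu (- lambda)) u))
  (mulop_funE (iota_e mu (- lambda)) u) => xi /= -> // -> // _.
rewrite mulrA -bohrD subrr (_ : bohr_fun xi 0 = 1) ?mul1r//.
by apply: (mulIf (bohr_neq0 xi 0)); rewrite mul1r -bohrD addr0.
Qed.
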